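(* There is an absolute constant $C>0$ such that the following holds. Let $m,n$ be positive integers, $M=\{1,\dots,m\}$, $N=\{1,\dots,n\}$, $A\in\mathbb{R}^{M\times N}$ with $\mathrm{rk}(A)=m$, $b\in\mathbb{R}^M$, and consider the NNLS problem $\min\{\tfrac12\|Ax-b\|^2 : x\in\mathbb{R}^N,\ x\ge \mathbf{0}\}$. Let $\Psi$ be any cycle-free centroid mapping, and run the Update-and-Stabilize algorithm (described in the context) with $\Psi$, initialized with $x=\mathbf{0}$. Write $\kappa=\kappa(\mathcal{X}_A)$. (i) With projected gradient updates, the algorithm terminates with an optimal solution in at most $C\, n\, m^2\,\kappa^2\,\|A\|^2\,\log(n+\kappa)$ major cycles. (ii) With coordinate updates, the algorithm terminates with an optimal solution in at most $C\, n^2 m^2\,\kappa^2\,\|A\|^2\,\log(n+\kappa)$ major cycles. In both cases, the total number of minor cycles is at most $C\, n^2 m^2\,\kappa^2\,\|A\|^2\,\log(n+\kappa)$.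
   Context: $\|\cdot\|$ is the Euclidean norm of vectors and the spectral ($\ell_2\to\ell_2$ operator) norm of matrices. $A^j$ is the $j$th column of $A$. **Circuit imbalance.** For a linear subspace $W$, an elementary vector is a nonzero vector of $W$ of inclusion-minimal support; $\mathcal F(W)$ is the set of elementary vectors. For nontrivial $W$ (neither $\{\mathbf 0\}$ nor the whole space), $\kappa(W):=\max\{|g(j)/g(i)| : g\in\mathcal F(W),\ i,j\in\mathrm{supp}(g)\}$; $\kappa(W)=1$ for trivial $W$. Let $\mathcal X_A:=\ker(A\mid -I_M)\subset\mathbb{R}^{N\oplus M}$, i.e. $\mathcal X_A=\{(v,Av):v\in\mathbb{R}^N\}$. **Cycle-free vectors.** A vector $y$ conforms to $x$ if $x(i)y(i)>0$ whenever $y(i)\ne0$. A generalized path-circuit decomposition of $v\in\mathbb{R}^N$ with respect to $A$ is a decomposition $v=\sum_{k=1}^\ell h^k$ with $\ell\le n$ where each $(h^k,Ah^k)$ is an elementary vector of $\mathcal X_A$ conforming to $(v,Av)$. $h^k$ is an inner vector if $Ah^k=\mathbf 0$ and an outer vector otherwise. $v$ is cycle-free w.r.t. $A$ if all its generalized path-circuit decompositions contain outer vectors only. **Centroid mappings (NNLS case).** For $x\ge\mathbf 0$ let $I_0(x)=\{i\in N:x(i)=0\}$, $J(x)=N\setminus I_0(x)$, and $\mathcal C(x):=\arg\min_y\{\|Ay-b\| : y\in\mathbb{R}^N,\ y(i)=0\ \forall i\in I_0(x)\}$. A centroid mapping is a map $\Psi:\mathbb{R}^N_{\ge0}\to\mathbb{R}^N$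 with $\Psi(x)\in\mathcal C(x)$ for all $x\ge \mathbf 0$ and $\Psi(\Psi(x))=\Psi(x)$ whenever $\Psi(x)\ge\mathbf 0$. It is cycle-free if $\Psi(x)-x$ is cycle-free w.r.t. $A$ for every $x\ge\mathbf 0$. A point $x\ge\mathbf 0$ is stable if $\Psi(x)=x$. **Algorithm.** Start from an initial point $x$. Repeat the following major cycle until $x=\mathrm{Update}(x)$, then return $x$: set $x\leftarrow\mathrm{Update}(x)$; then, while $\Psi(x)\neq x$, perform a minor cycle: let $w=\Psi(x)$, let $\alpha^*$ be the largest $\alpha\in[0,1]$ with $x+\alpha(w-x)\ge\mathbf 0$, and set $x\leftarrow x+\alpha^*(w-x)$. (Thus $x$ is stable at the end of each major cycle; $x=\mathbf 0$ is stable.) **Updates at a stable point $x$.** Let $g^x=A^\top(Ax-b)$ and $z(i)=\max\{-g^x(i),0\}$ for $i\in N$. If $z=\mathbf 0$, then $\mathrm{Update}(x)=x$. Otherwise: - Projected gradient update: $\mathrm{Update}(x)=x+\frac{\|z\|^2}{\|Az\|^2}z$. - Coordinate update: choose $j\in\arg\max_k z(k)$ (then $j\in I_0(x)$) and let $\mathrm{Update}(x)=y$ with $y(i)=x(i)$ for $i\ne j$ and $y(j)=z(j)/\|A^j\|^2$. *)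

(* Defs.v *)
From HB Require Import structures.
From mathcomp Require Export all_boot all_order all_algebra.
From mathcomp Require Export boolp classical_sets reals exp.

Set Implicit Arguments.
Unset Strict Implicit.
Unset Printing Implicit Defensive.

Import Order.TTheory GRing.Theory Num.Theory.
Local Open Scope ring_scope.

(* Vectors of R^k are column vectors 'cV[R]_k; the index sets N and M are 'I_n
   and 'I_m, and their disjoint union is 'I_(n + m). *)

(* The norm `| _ | that MathComp-Analysis puts on matrices is the max norm, so
   the Euclidean and spectral norms are defined here. *)
Definition enorm (R : realType) (k : nat) (x : 'cV[R]_k) : R :=
  Num.sqrt (\sum_(i < k) x i 0 ^+ 2).

Definition spectral_norm (R : realType) (m n : nat) (A : 'M[R]_(m, n)) : R :=
  sup [set r : R | exists v : 'cV[R]_n, enorm v <= 1 /\ r = enorm (A *m v)]%classic.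

Definition nonneg (R : realType) (k : nat) (x : 'cV[R]_k) : Prop :=
  forall i, 0 <= x i 0.

Definition supp (R : realType) (k : nat) (x : 'cV[R]_k) : {set 'I_k} :=
  [set i | x i 0 != 0]%SET.

Definition elementary (R : realType) (k : nat) (W : {vspace 'cV[R]_k})
    (g : 'cV[R]_k) : Prop :=
  [/\ g \in W, g != 0 &
      forall h, h \in W -> h != 0 -> ~~ (supp h \proper supp g)].

(* An elementary vector is determined by its support up to a scalar, so the set
   below is finite, and it is nonempty when W is nontrivial: sup is a max. *)
Definition circuit_imbalance (R : realType) (k : nat)
    (W : {vspace 'cV[R]_k}) : R :=
  if (W == 0%VS) || (W == fullv) then 1 else
  sup [set r : R | exists g i j, [/\ elementary W g, i \in supp g, j \in supp g
                                   & r = `|g j 0 / g i 0|]]%classic.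

Definition XA (R : realType) (m n : nat) (A : 'M[R]_(m, n)) :
    {vspace 'cV[R]_(n + m)} :=
  lker (linfun (mulmx (row_mx A (- 1%:M)) : 'cV[R]_(n + m) -> 'cV[R]_m)).

Definition conforms (R : realType) (k : nat) (y x : 'cV[R]_k) : Prop :=
  forall i, y i 0 != 0 -> 0 < x i 0 * y i 0.

Definition path_circuit_decomposition (R : realType) (m n : nat)
    (A : 'M[R]_(m, n)) (v : 'cV[R]_n) (l : nat) (h : 'I_l -> 'cV[R]_n) : Prop :=
  [/\ (l <= n)%N, v = \sum_(k < l) h k &
      forall k, elementary (XA A) (col_mx (h k) (A *m h k)) /\
                conforms (col_mx (h k) (A *m h k)) (col_mx v (A *m v))].

Definition inner_vector (R : realType) (m n : nat) (A : 'M[R]_(m, n))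
    (h : 'cV[R]_n) : Prop := A *m h = 0.

Definition cycle_free (R : realType) (m n : nat) (A : 'M[R]_(m, n))
    (v : 'cV[R]_n) : Prop :=
  forall (l : nat) (h : 'I_l -> 'cV[R]_n),
    path_circuit_decomposition A v h -> forall k, ~ inner_vector A (h k).

Definition in_centroid_set (R : realType) (m n : nat) (A : 'M[R]_(m, n))
    (b : 'cV[R]_m) (x y : 'cV[R]_n) : Prop :=
  let feasible (u : 'cV[R]_n) := forall i, x i 0 = 0 -> u i 0 = 0 in
  feasible y /\
  forall u, feasible u -> enorm (A *m y - b) <= enorm (A *m u - b).

(* Centroid mappings are defined on nonnegative vectors only: Psi is a total
   function, and its values elsewhere are neither constrained nor used. *)
Definition centroid_mapping (R : realType) (m n : nat) (A : 'M[R]_(m, n))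
    (b : 'cV[R]_m) (Psi : 'cV[R]_n -> 'cV[R]_n) : Prop :=
  forall x, nonneg x ->
    in_centroid_set A b x (Psi x) /\ (nonneg (Psi x) -> Psi (Psi x) = Psi x).

Definition cycle_free_centroid_mapping (R : realType) (m n : nat)
    (A : 'M[R]_(m, n)) (b : 'cV[R]_m) (Psi : 'cV[R]_n -> 'cV[R]_n) : Prop :=
  centroid_mapping A b Psi /\
  forall x, nonneg x -> cycle_free A (Psi x - x).

Definition optimal (R : realType) (m n : nat) (A : 'M[R]_(m, n))
    (b : 'cV[R]_m) (x : 'cV[R]_n) : Prop :=
  nonneg x /\
  forall y, nonneg y ->
    1 / 2 * enorm (A *m x - b) ^+ 2 <= 1 / 2 * enorm (A *m y - b) ^+ 2.

Definition gradient (R : realType) (m n : nat) (A : 'M[R]_(m, n))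
    (b : 'cV[R]_m) (x : 'cV[R]_n) : 'cV[R]_n := A^T *m (A *m x - b).

Definition descent (R : realType) (m n : nat) (A : 'M[R]_(m, n))
    (b : 'cV[R]_m) (x : 'cV[R]_n) : 'cV[R]_n :=
  \col_i Num.max (- gradient A b x i 0) 0.

(* Updates are relations, [update x y] meaning that y is an admissible value of
   Update(x): the coordinate update may pick any maximizer. *)
Definition projected_gradient_update (R : realType) (m n : nat)
    (A : 'M[R]_(m, n)) (b : 'cV[R]_m) (x y : 'cV[R]_n) : Prop :=
  let z := descent A b x in
  if z == 0 then y = x
  else y = x + (enorm z ^+ 2 / enorm (A *m z) ^+ 2) *: z.

Definition coordinate_update (R : realType) (m n : nat)
    (A : 'M[R]_(m, n)) (b : 'cV[R]_m) (x y : 'cV[R]_n) : Prop :=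
  let z := descent A b x in
  if z == 0 then y = x
  else exists j, (forall k, z k 0 <= z j 0) /\
         y = \col_i (if i == j then z j 0 / enorm (col j A) ^+ 2 else x i 0).

Definition minor_cycle (R : realType) (n : nat) (Psi : 'cV[R]_n -> 'cV[R]_n)
    (x y : 'cV[R]_n) : Prop :=
  let w := Psi x in
  let admissible (a : R) := 0 <= a <= 1 /\ nonneg (x + a *: (w - x)) in
  exists a, [/\ admissible a, forall a', admissible a' -> a' <= a
              & y = x + a *: (w - x)].

(* Program points: before a major cycle, in the while loop of minor cycles, and
   after the return. *)
Inductive config (R : realType) (n : nat) : Type :=
| Major of 'cV[R]_n
| Minor of 'cV[R]_n
| Returned of 'cV[R]_n.

(* [run update Psi x0 c p q]: the algorithm started at x0 can reach c after
   starting p major cycles and performing q minor cycles in total. *)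
Inductive run (R : realType) (n : nat) (update : 'cV[R]_n -> 'cV[R]_n -> Prop)
    (Psi : 'cV[R]_n -> 'cV[R]_n) (x0 : 'cV[R]_n) :
    config R n -> nat -> nat -> Prop :=
| run_start : run update Psi x0 (Major x0) 0%N 0%N
| run_update x y p q : run update Psi x0 (Major x) p q ->
    update x y -> run update Psi x0 (Minor y) p.+1 q
| run_minor x y p q : run update Psi x0 (Minor x) p q ->
    Psi x <> x -> minor_cycle Psi x y -> run update Psi x0 (Minor y) p q.+1
| run_repeat x p q : run update Psi x0 (Minor x) p q ->
    Psi x = x -> ~ update x x -> run update Psi x0 (Major x) p q
| run_return x p q : run update Psi x0 (Minor x) p q ->
    Psi x = x -> update x x -> run update Psi x0 (Returned x) p q.

Definition can_continue (R : realType) (n : nat)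
    (update : 'cV[R]_n -> 'cV[R]_n -> Prop) (Psi : 'cV[R]_n -> 'cV[R]_n)
    (c : config R n) : Prop :=
  match c with
  | Major x => exists y, update x y
  | Minor x => Psi x <> x -> exists y, minor_cycle Psi x y
  | Returned _ => False
  end.

(* Whatever choices are made, executions have bounded length (between two
   consecutive counted events there is at most one uncounted transition), and
   one that cannot be continued has returned an optimal solution. *)
Definition solves_within (R : realType) (m n : nat) (A : 'M[R]_(m, n))
    (b : 'cV[R]_m) (update : 'cV[R]_n -> 'cV[R]_n -> Prop)
    (Psi : 'cV[R]_n -> 'cV[R]_n) (x0 : 'cV[R]_n) (major minor : R) : Prop :=
  forall c p q, run update Psi x0 c p q ->
    [/\ p%:R <= major, q%:R <= minor &
        can_continue update Psi c \/ exists2 x, c = Returned x & optimal A b x].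

(* Main.v *)
Require Import Defs.
From mathcomp Require Import all_boot all_order all_algebra.
From mathcomp Require Import boolp classical_sets reals exp.
From mathcomp Require Import sequences.
From mathcomp Require Import ring lra zify.
Import Order.TTheory GRing.Theory Num.Theory.
Local Open Scope ring_scope.

Set Implicit Arguments.
Unset Strict Implicit.
Unset Printing Implicit Defensive.

(** The gap of a feasible point [x] is its cost [|Ax - b|^2] minus the optimal
cost.  The proof combines a linear rate of convergence of the gap with the
observation that, each time the gap has dropped by a polynomial factor in
[n + kappa], a new variable gets fixed.

Circuits.  Every vector [(v, Av)] of the space [XA A] is a conformal sum of
elementary vectors ([conformal_decomposition]).  An outer elementary vector
[(h, Ah)] has at most [m] nonzero entries in [h] ([card_supp_outer]), each at
most [kappa] times any nonzero entry of [Ah].  As conforming vectors do not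
cancel, [|v| <= m * kappa * |Av|] whenever only outer vectors occur in a
decomposition of [v] ([enorm_outer_sum]).  This applies to the steps towards a
centroid, since the centroid mapping is cycle-free, and, after the inner vectors
are removed ([remove_inner]), to the way from a feasible point to an optimal one.
The entries of [A] are themselves ratios of entries of elementary vectors, so
[A] is bounded in terms of [kappa].

Rate.  Let [z] be the descent vector at a stable point [x].  The gradient
vanishes on the support of [x], and an optimal point lies within
[m * kappa * |Ax - p|] of [x], where [p] is the optimal image; together they give
[gap x <= (m * kappa * |z|)^2] ([gap_le_descent_sqr]).  An exact line search along
[z], or along its largest coordinate, closes at least the fraction [1 / D] of the
gap, where [D] is [(m * kappa * |A|)^2], respectively [n] times that number
([projected_gradient_decreasing], [coordinate_decreasing]).  Minor cycles do not
increase the cost ([minor_cycle_decrease]).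

Fixing variables.  Every step moves [x] by at most the order of
[m * kappa * sqrt (gap x)], and the gap decreases geometrically, so all future
movement is bounded by [threshold * sqrt (gap x)]: coordinates above this value
stay positive forever ([large_subset]).  As long as the set of large coordinates
does not grow, it is contained in the support of the stable point [x0] at which
the current phase began.  That point minimizes the cost over its support, so it
is at least as good as the current point with the other, tiny coordinates set to
zero; hence [gap x0] exceeds the current gap by at most a polynomial factor
([gap_before_drop]).  At the above rate a phase therefore lasts
[O(D * ln (n + kappa))] major cycles, and there are at most [n + 1] phases.

Minor cycles.  Each of them but the last in its major cycle removes an index from
the support, and an update adds at most [n], respectively one, so they are
counted by the support size.

An optimal solution exists because every feasible point is dominated by a stable
one and the cost of a stable point is determined by its support
([optimum_exists]). *)

(** * Euclidean geometry *)

Section Euclid.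
Context {R : realType}.

Definition dot (k : nat) (x y : 'cV[R]_k) : R := \sum_(i < k) x i 0 * y i 0.

Lemma dotC k (x y : 'cV[R]_k) : dot x y = dot y x.
Proof. by apply: eq_bigr => i _; rewrite mulrC. Qed.

Lemma dotDl k (x y z : 'cV[R]_k) : dot (x + y) z = dot x z + dot y z.
Proof. by rewrite -big_split; apply: eq_bigr => i _; rewrite mxE mulrDl. Qed.

Lemma dotZl k a (x y : 'cV[R]_k) : dot (a *: x) y = a * dot x y.
Proof. by rewrite big_distrr; apply: eq_bigr => i _; rewrite mxE /= mulrA. Qed.

Lemma dotDr k (x y z : 'cV[R]_k) : dot x (y + z) = dot x y + dot x z.
Proof. by rewrite dotC dotDl !(dotC x). Qed.

Lemma dotZr k a (x y : 'cV[R]_k) : dot x (a *: y) = a * dot x y.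
Proof. by rewrite dotC dotZl dotC. Qed.

Lemma dotNl k (x y : 'cV[R]_k) : dot (- x) y = - dot x y.
Proof. by rewrite -scaleN1r dotZl mulN1r. Qed.

Lemma dotNr k (x y : 'cV[R]_k) : dot x (- y) = - dot x y.
Proof. by rewrite -scaleN1r dotZr mulN1r. Qed.

Definition dotE := (dotDl, dotDr, dotNl, dotNr, dotZl, dotZr).

Lemma dot_delta k (x : 'cV[R]_k) i : dot x (delta_mx i 0) = x i 0.
Proof.
rewrite /dot (bigD1 i) //= big1 ?addr0 ?mxE ?eqxx ?mulr1 // => j ji.
by rewrite !mxE (negbTE ji) mulr0.
Qed.

Lemma dot_mulmx m n (A : 'M[R]_(m, n)) (v : 'cV[R]_n) (u : 'cV[R]_m) :
  dot (A *m v) u = dot v (A^T *m u).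
Proof.
transitivity (\sum_i \sum_j A i j * v j 0 * u i 0).
  by apply: eq_bigr => i _; rewrite mxE big_distrl.
rewrite exchange_big; apply: eq_bigr => j _; rewrite mxE big_distrr.
by apply: eq_bigr => i _; rewrite mxE -mulrA mulrCA.
Qed.

Lemma dotvv_ge0 k (x : 'cV[R]_k) : 0 <= dot x x.
Proof. by apply: sumr_ge0 => i _; rewrite -expr2 sqr_ge0. Qed.

Lemma enorm_sqr k (x : 'cV[R]_k) : enorm x ^+ 2 = dot x x.
Proof.
rewrite /enorm sqr_sqrtr; last by apply: sumr_ge0 => i _; rewrite sqr_ge0.
by apply: eq_bigr => i _; rewrite expr2.
Qed.

Lemma enorm_ge0 k (x : 'cV[R]_k) : 0 <= enorm x.
Proof. exact: sqrtr_ge0. Qed.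

Lemma enorm0 k : enorm (0 : 'cV[R]_k) = 0.
Proof.
by rewrite /enorm big1 ?sqrtr0 // => i _; rewrite mxE expr0n.
Qed.

Lemma enorm_eq0 k (x : 'cV[R]_k) : (enorm x == 0) = (x == 0).
Proof.
apply/eqP/eqP => [x0|->]; last exact: enorm0.
have : dot x x = 0 by rewrite -enorm_sqr x0 expr0n.
move=> /eqP; rewrite psumr_eq0; last by move=> i _; rewrite -expr2 sqr_ge0.
move=> /allP h; apply/colP => i; rewrite mxE; apply/eqP.
by have := h i (mem_index_enum i); rewrite /= mulf_eq0 orbb.
Qed.

Lemma enorm_gt0 k (x : 'cV[R]_k) : (0 < enorm x) = (x != 0).
Proof. by rewrite lt_def enorm_ge0 andbT enorm_eq0. Qed.

Lemma enormZ k a (x : 'cV[R]_k) : enorm (a *: x) = `|a| * enorm x.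
Proof.
apply/eqP; rewrite -(eqrXn2 (n := 2)) ?mulr_ge0 ?enorm_ge0 //.
by rewrite exprMn !enorm_sqr !dotE mulrA real_normK ?num_real.
Qed.

Lemma enormN k (x : 'cV[R]_k) : enorm (- x) = enorm x.
Proof. by rewrite -scaleN1r enormZ normrN1 mul1r. Qed.

Lemma cauchy_schwarz k (x y : 'cV[R]_k) : dot x y <= enorm x * enorm y.
Proof.
have [->|x0] := eqVneq x 0.
  by rewrite enorm0 mul0r /dot big1 // => i _; rewrite mxE mul0r.
have [->|y0] := eqVneq y 0.
  by rewrite enorm0 mulr0 /dot big1 // => i _; rewrite mxE mulr0.
have xy : 0 < enorm x * enorm y by rewrite mulr_gt0 ?enorm_gt0.
have := dotvv_ge0 (enorm y *: x - enorm x *: y).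
rewrite !dotE (dotC y x) -!enorm_sqr => h.
by rewrite -(ler_pM2l xy); nra.
Qed.

Lemma enorm_triangle k (x y : 'cV[R]_k) : enorm (x + y) <= enorm x + enorm y.
Proof.
rewrite -(ler_pXn2r (n := 2)) ?nnegrE ?addr_ge0 ?enorm_ge0 //.
rewrite sqrrD !enorm_sqr !dotE (dotC y x).
by have := cauchy_schwarz x y; lra.
Qed.

Lemma enorm_sum k (I : Type) (r : seq I) (P : pred I) (F : I -> 'cV[R]_k) :
  enorm (\sum_(i <- r | P i) F i) <= \sum_(i <- r | P i) enorm (F i).
Proof.
elim/big_rec2: _ => [|i y x _ h]; first by rewrite enorm0.
by apply: le_trans (enorm_triangle _ _) _; rewrite lerD2l.
Qed.

Lemma coord_le_enorm k (x : 'cV[R]_k) i : `|x i 0| <= enorm x.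
Proof.
rewrite -(ler_pXn2r (n := 2)) ?nnegrE ?enorm_ge0 //.
rewrite real_normK ?num_real // enorm_sqr /dot (bigD1 i) //= -expr2 lerDl.
by apply: sumr_ge0 => j _; rewrite -expr2 sqr_ge0.
Qed.

(** Cauchy-Schwarz against the sign vector. *)
Lemma sum_norm_le_enorm k (x : 'cV[R]_k) :
  \sum_i `|x i 0| <= Num.sqrt k%:R * enorm x.
Proof.
pose s : 'cV[R]_k := \col_i Num.sg (x i 0).
have -> : \sum_i `|x i 0| = dot s x.
  by apply: eq_bigr => i _; rewrite mxE normrEsg.
apply: le_trans (cauchy_schwarz _ _) _; rewrite ler_wpM2r ?enorm_ge0 //.
rewrite ler_wsqrtr // -[k in leRHS]card_ord -sumr_const ler_sum // => i _.
by rewrite mxE -real_normK ?num_real // normr_sg; case: eqP; rewrite ?expr1n ?expr0n.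
Qed.

Lemma enorm_le_card k (x : 'cV[R]_k) (S : {set 'I_k}) (c : R) : 0 <= c ->
  (forall i, `|x i 0| <= c) -> supp x \subset S ->
  enorm x <= Num.sqrt #|S|%:R * c.
Proof.
move=> c0 xc /fintype.subsetP xS.
rewrite -[c]ger0_norm // -sqrtr_sqr -sqrtrM ?ler0n //.
rewrite ler_wsqrtr // (bigID (mem S)) /= [X in _ + X]big1 ?addr0.
  rewrite mulr_natl -sumr_const ler_sum // => i _.
  by rewrite -real_normK ?num_real // ler_pXn2r ?nnegrE.
move=> i iS; have : i \notin supp x by apply: contra iS => /xS.
by rewrite inE negbK => /eqP ->; rewrite expr0n.
Qed.

(** * The spectral norm *)

Lemma enorm_mulmx_entries m n (A : 'M[R]_(m, n)) (c : R) (v : 'cV[R]_n) :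
  0 <= c -> (forall i j, `|A i j| <= c) ->
  enorm (A *m v) <= Num.sqrt (m%:R * n%:R) * c * enorm v.
Proof.
move=> c0 Ac.
have rowE i : (A *m v) i 0 = dot (row i A)^T v.
  by rewrite mxE; apply: eq_bigr => j _; rewrite !mxE.
have row_le i : enorm (row i A)^T <= Num.sqrt n%:R * c.
  rewrite -[n in leRHS]card_ord -cardsT; apply: enorm_le_card => //.
  by move=> j; rewrite !mxE.
apply: (@le_trans _ _ (Num.sqrt #|[set: 'I_m]|%:R *
                        (Num.sqrt n%:R * c * enorm v))).
  apply: enorm_le_card => //.
    by rewrite mulr_ge0 ?enorm_ge0 // mulr_ge0 ?sqrtr_ge0.
  move=> i; rewrite rowE ler_norml -lerNl -dotNl.
  apply/andP; split.
    apply: le_trans (cauchy_schwarz _ _) _.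
    by rewrite enormN ler_wpM2r ?enorm_ge0.
  by apply: le_trans (cauchy_schwarz _ _) _; rewrite ler_wpM2r ?enorm_ge0.
by rewrite cardsT card_ord sqrtrM ?ler0n // !mulrA.
Qed.

Lemma spectral_norm_ub m n (A : 'M[R]_(m, n)) (v : 'cV[R]_n) :
  enorm v <= 1 -> enorm (A *m v) <= spectral_norm A.
Proof.
move=> v1; apply: ub_le_sup; last by exists v.
pose c := \sum_i \sum_j `|A i j|.
have c0 : 0 <= c by apply: sumr_ge0 => i _; apply: sumr_ge0.
have Ac i j : `|A i j| <= c.
  rewrite /c (bigD1 i) //= (bigD1 j) //= -addrA lerDl.
  by rewrite addr_ge0 // sumr_ge0 // => ? _; rewrite ?sumr_ge0.
exists (Num.sqrt (m%:R * n%:R) * c) => _ [w [w1 ->]].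
apply: le_trans (enorm_mulmx_entries _ c0 Ac) _.
by rewrite ler_piMr // mulr_ge0 ?sqrtr_ge0.
Qed.

Lemma spectral_norm_ge0 m n (A : 'M[R]_(m, n)) : 0 <= spectral_norm A.
Proof.
by rewrite -(enorm0 m) -(mulmx0 1 A) spectral_norm_ub // enorm0.
Qed.

Lemma enorm_mulmx_le m n (A : 'M[R]_(m, n)) (v : 'cV[R]_n) :
  enorm (A *m v) <= spectral_norm A * enorm v.
Proof.
have [->|v0] := eqVneq v 0; first by rewrite mulmx0 !enorm0 mulr0.
rewrite -ler_pdivrMr ?enorm_gt0 // mulrC -[(enorm v)^-1]ger0_norm; last first.
  by rewrite invr_ge0 enorm_ge0.
rewrite -enormZ scalemxAr spectral_norm_ub //.
by rewrite enormZ ger0_norm ?invr_ge0 ?enorm_ge0 // mulVf ?enorm_eq0.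
Qed.

Lemma spectral_norm_le m n (A : 'M[R]_(m, n)) (c : R) : 0 <= c ->
  (forall v, enorm (A *m v) <= c * enorm v) -> spectral_norm A <= c.
Proof.
move=> c0 Ac; apply: ge_sup.
  by exists (enorm (A *m 0)), 0; rewrite enorm0.
move=> _ [v [v1 ->]]; apply: le_trans (Ac v) _.
by rewrite ler_piMr.
Qed.

Lemma enorm_delta k (i : 'I_k) : enorm (delta_mx i 0 : 'cV[R]_k) = 1.
Proof.
by apply/eqP; rewrite -(eqrXn2 (n := 2)) ?enorm_ge0 // enorm_sqr dot_delta mxE
  !eqxx expr1n.
Qed.

Lemma entry_le_spectral_norm m n (A : 'M[R]_(m, n)) i j :
  `|A i j| <= spectral_norm A.
Proof.
have := enorm_mulmx_le A (delta_mx j 0); rewrite enorm_delta mulr1.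
apply: le_trans; have := coord_le_enorm (A *m delta_mx j 0) i.
by rewrite -colE mxE.
Qed.

Lemma col_le_spectral_norm m n (A : 'M[R]_(m, n)) j :
  enorm (col j A) <= spectral_norm A.
Proof.
by have := enorm_mulmx_le A (delta_mx j 0); rewrite enorm_delta mulr1 -colE.
Qed.

End Euclid.

(** * Elementary vectors and conformal decompositions *)

Section Conformal.
Context {R : realType} {k : nat}.
Implicit Types (v h g : 'cV[R]_k) (W : {vspace 'cV[R]_k}).

Lemma in_supp v i : (i \in supp v) = (v i 0 != 0).
Proof. by rewrite inE. Qed.

Lemma conforms_refl v : conforms v v.
Proof. by move=> i vi; rewrite -expr2 exprn_even_gt0. Qed.

Lemma conforms_trans g h v : conforms g h -> conforms h v -> conforms g v.
Proof.
move=> gh hv i gi; have hg := gh i gi.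
have hi : h i 0 != 0 by apply: contraTneq hg => ->; rewrite mul0r ltxx.
have vh := hv i hi; have h2 : 0 < h i 0 ^+ 2 by rewrite exprn_even_gt0.
by rewrite -(pmulr_lgt0 _ h2); have := mulr_gt0 hg vh; congr (_ < _); ring.
Qed.

Lemma conforms_supp g v : conforms g v -> supp g \subset supp v.
Proof.
move=> gv; apply/fintype.subsetP => i; rewrite !in_supp => /gv.
by apply: contraTneq => ->; rewrite mul0r ltxx.
Qed.

Lemma conformsZ a g v : 0 < a -> conforms g v -> conforms (a *: g) v.
Proof.
move=> a0 gv i; rewrite mxE mulf_eq0 negb_or => /andP[_ /gv].
by move=> vg; rewrite mulrCA pmulr_rgt0.
Qed.

Lemma suppZ a v : a != 0 -> supp (a *: v) = supp v.
Proof. by move=> a0; apply/setP => i; rewrite !in_supp mxE mulf_eq0 negb_or a0. Qed.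

Lemma supp_eq0 v : (supp v == finset.set0) = (v == 0).
Proof.
apply/eqP/eqP => [v0|->].
  apply/colP => i; rewrite mxE; apply/eqP.
  by have : i \notin supp v by [rewrite v0 inE]; rewrite in_supp negbK.
by apply/setP => i; rewrite in_supp mxE eqxx inE.
Qed.

Lemma elementaryZ W a g : a != 0 -> elementary W g -> elementary W (a *: g).
Proof.
move=> a0 [gW g0 gmin]; split; first exact: memvZ.
  by rewrite scaler_eq0 negb_or a0.
by move=> h hW h0; rewrite suppZ // gmin.
Qed.

(** The ratio test of the simplex method: the largest step along [h] that changes
no sign of [v] stops because an entry becomes zero. *)
Lemma ratio_test v h :
  supp h \subset supp v -> (exists j, 0 < v j 0 * h j 0) ->
  exists2 a, 0 < a &
    conforms (v - a *: h) v /\ supp (v - a *: h) \proper supp v.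
Proof.
move=> /fintype.subsetP hv [j0 j0P].
case: (@arg_minP _ _ _ j0 (fun j => 0 < v j 0 * h j 0)
         (fun j => v j 0 / h j 0) j0P) => j jP jmin.
have nz i : 0 < v i 0 * h i 0 -> h i 0 != 0.
  by apply: contraTneq => ->; rewrite mulr0 ltxx.
have ratio i : 0 < v i 0 * h i 0 -> v i 0 / h i 0 * h i 0 = v i 0.
  by move/nz => hi; rewrite divfK.
have a0 : 0 < v j 0 / h j 0.
  have h2 : 0 < h j 0 ^+ 2 by rewrite exprn_even_gt0 // nz.
  by rewrite -(pmulr_lgt0 _ h2) expr2 mulrA ratio.
exists (v j 0 / h j 0) => //; set a := v j 0 / h j 0 in a0 *.
have hv0 i : v i 0 = 0 -> h i 0 = 0.
  move=> vi; apply/eqP; apply: contraT => hi.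
  by have := hv i; rewrite !in_supp hi vi eqxx => /(_ isT).
have cf : conforms (v - a *: h) v.
  move=> i; rewrite !mxE => ui.
  have vi : v i 0 != 0.
    by apply: contraNneq ui => vi; rewrite vi (hv0 _ vi) mulr0 subr0.
  have [vhi|vhi] := ltP 0 (v i 0 * h i 0); last first.
    have : 0 < v i 0 ^+ 2 by rewrite exprn_even_gt0.
    by move=> v2; have := mulr_ge0_le0 (ltW a0) vhi; nra.
  rewrite lt_def mulf_neq0 //= mulrBr subr_ge0 mulrCA.
  apply: le_trans (_ : v i 0 / h i 0 * (v i 0 * h i 0) <= _).
    by rewrite ler_pM2r // jmin.
  by rewrite mulrCA ratio.
split => //; rewrite properE conforms_supp //=.
apply/negP => /fintype.subsetP /(_ j); rewrite !in_supp !mxE /a ratio // subrr eqxx.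
move=> /(_ _)/notF; apply.
by apply: contraTneq jP => ->; rewrite mul0r ltxx.
Qed.

(** Descent on the support: unless [v] is elementary, the ratio test along a
vector of smaller support yields a conforming vector of smaller support. *)
Lemma conforming_elementary W v : v \in W -> v != 0 ->
  exists2 g, elementary W g & conforms g v.
Proof.
have [c] := ubnP #|supp v|; elim: c v => // c IH v vc vW v0.
case: (pselect (elementary W v)) => [ev|nev].
  by exists v => //; exact: conforms_refl.
have [h [hW h0 hv]] : exists h, [/\ h \in W, h != 0 & supp h \proper supp v].
  apply: contrapT => no; apply: nev; split => // h hW h0.
  by apply/negP => hv; apply: no; exists h.
wlog hj : h hW h0 hv / exists j, 0 < v j 0 * h j 0.
  move=> wl; have /set0Pn[j] : supp h != finset.set0 by rewrite supp_eq0.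
  move=> jh; have jv := fintype.subsetP (proper_sub hv) _ jh.
  move: jh jv; rewrite !in_supp => jh jv.
  have : v j 0 * h j 0 != 0 by rewrite mulf_neq0.
  rewrite neq_lt => /orP[vh|vh]; last by apply: (wl h) => //; exists j.
  apply: (wl (-1 *: h)); rewrite ?memvZ ?suppZ ?oppr_eq0 ?oner_eq0 //.
    by rewrite scaleN1r oppr_eq0.
  by exists j; rewrite mxE mulN1r mulrN oppr_gt0.
have [a a0 [cf pr]] := ratio_test (proper_sub hv) hj.
have uW : v - a *: h \in W by rewrite memvB // memvZ.
have u0 : v - a *: h != 0.
  apply/eqP => /eqP; rewrite subr_eq0 => /eqP va.
  by move: hv; rewrite va suppZ ?gt_eqF // fintype.properxx.
have [] := IH (v - a *: h) _ uW u0.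
  by apply: leq_trans (proper_card pr) _; rewrite -ltnS.
by move=> g eg gu; exists g => //; exact: conforms_trans cf.
Qed.

(** The diagonal matrix projects onto the coordinates outside [S]. *)
Definition supported W (S : {set 'I_k}) : {vspace 'cV[R]_k} :=
  (W :&: lker (linfun (mulmx (diag_mx (\row_i (i \notin S)%:R : 'rV[R]_k)) :
                        'cV[R]_k -> 'cV[R]_k)))%VS.

Lemma mem_supported W (S : {set 'I_k}) v :
  (v \in supported W S) = (v \in W) && (supp v \subset S).
Proof.
rewrite memv_cap memv_ker lfunE /=; congr (_ && _).
apply/eqP/fintype.subsetP => [v0 i|vS].
  rewrite in_supp; apply: contraNT => iS.
  by move/colP: v0 => /(_ i); rewrite mul_diag_mx !mxE iS mul1r => ->.
apply/colP => i; rewrite mul_diag_mx !mxE.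
case: (boolP (i \in S)) => iS; first by rewrite mul0r.
rewrite mul1r; apply/eqP; apply: contraNT iS => vi.
by apply: vS; rewrite in_supp.
Qed.

(** Peeling off a conforming elementary vector removes an entry of the support
of [v], and [v] itself then leaves the space of vectors of [W] with that
support.  Counting dimensions of these spaces, not entries, bounds the number of
terms by the dimension of [W]. *)
Lemma conformal_decomposition W v : v \in W ->
  exists s : seq 'cV[R]_k,
    [/\ (size s <= \dim W)%N, v = \sum_(g <- s) g &
        forall g, g \in s -> elementary W g /\ conforms g v].
Proof.
move=> vW; suff {vW} : forall d v, v \in W ->
    (\dim (supported W (supp v)) <= d)%N ->
  exists s : seq 'cV[R]_k,
    [/\ (size s <= d)%N, v = \sum_(g <- s) g &
        forall g, g \in s -> elementary W g /\ conforms g v].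
  by apply => //; apply: dimvS; apply: capvSl.
elim=> [|d IH] {}v vW dv.
  exists [::]; rewrite big_nil; split => //.
  have : v \in supported W (supp v) by rewrite mem_supported vW /=.
  by move: dv; rewrite leqn0 dimv_eq0 => /eqP ->; rewrite memv0 => /eqP.
have [->|v0] := eqVneq v 0; first by exists [::]; rewrite big_nil.
have [g eg gv] := conforming_elementary vW v0.
have gj : exists j, 0 < v j 0 * g j 0.
  have [_ g0 _] := eg; have /set0Pn[j] : supp g != finset.set0 by rewrite supp_eq0.
  by rewrite in_supp => /gv; exists j.
have [a a0 [cf pr]] := ratio_test (conforms_supp gv) gj.
have [gW _ _] := eg.
have uW : v - a *: g \in W by rewrite memvB // memvZ.
have [|s [sd us sP]] := IH _ uW.
  rewrite -ltnS; apply: leq_trans dv; rewrite ltnNge; apply/negP => du.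
  have /eqP E : supported W (supp (v - a *: g)) == supported W (supp v).
    rewrite eqEdim du andbT; apply/subvP => w; rewrite !mem_supported.
    by case/andP => -> /fintype.subset_trans ->//; exact: proper_sub.
  have : v \in supported W (supp v) by rewrite mem_supported vW /=.
  rewrite -E mem_supported vW /= => sv.
  by move: pr; rewrite properE sv andbF.
exists (a *: g :: s); split => //; first by rewrite big_cons -us addrC subrK.
move=> h; rewrite inE => /orP[/eqP ->|/sP[eh hu]].
  by split; [apply: elementaryZ; rewrite ?gt_eqF | exact: conformsZ].
by split => //; exact: conforms_trans cf.
Qed.

End Conformal.

(** * The space of the pairs (v, Av) *)

Section GraphSpace.
Context {R : realType} {m n : nat} (A : 'M[R]_(m, n)).

Lemma mem_XA (v : 'cV[R]_n) (u : 'cV[R]_m) :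
  (col_mx v u \in XA A) = (A *m v == u).
Proof.
by rewrite memv_ker lfunE /= mul_row_col mulNmx mul1mx subr_eq0.
Qed.

Lemma XA_colP (w : 'cV[R]_(n + m)) :
  w \in XA A -> w = col_mx (usubmx w) (A *m usubmx w).
Proof. by rewrite -[w in w \in _]vsubmxK mem_XA => /eqP ->; rewrite vsubmxK. Qed.

Lemma dim_XA : (\dim (XA A) <= n)%N.
Proof.
pose f : 'Hom('cV[R]_n, 'cV[R]_(n + m)) := linfun (mulmx (col_mx 1%:M A)).
have sub : (XA A <= limg f)%VS.
  apply/subvP => w /XA_colP ->; apply/memv_imgP; exists (usubmx w).
    by rewrite memvf.
  by rewrite lfunE /= mul_col_mx mul1mx.
apply: leq_trans (dimvS sub) _.
apply: (@leq_trans (\dim (fullv : {vspace 'cV[R]_n}))).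
  by rewrite -(limg_ker_dim f fullv) leq_addl.
by rewrite dimvf /dim /= muln1.
Qed.

Lemma path_circuit_decomposition_exists (v : 'cV[R]_n) :
  exists l (h : 'I_l -> 'cV[R]_n), path_circuit_decomposition A v h.
Proof.
have vW : col_mx v (A *m v) \in XA A by rewrite mem_XA.
have [s [sd vs sP]] := conformal_decomposition vW.
have gE (i : 'I_(size s)) : s`_i = col_mx (usubmx s`_i) (A *m usubmx s`_i).
  by have [[+ _ _] _] := sP _ (mem_nth 0 (ltn_ord i)) => /XA_colP.
exists (size s), (fun i => usubmx s`_i); split.
- exact: leq_trans sd dim_XA.
- rewrite -[LHS](col_mxKu v (A *m v)) vs (big_nth 0) big_mkord.
  by rewrite linear_sum.
- by move=> i; rewrite -gE; apply: sP; exact: mem_nth.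
Qed.

End GraphSpace.

(** * Circuit imbalance *)

Section Imbalance.
Context {R : realType} {k : nat} (W : {vspace 'cV[R]_k}).
Implicit Types g h v : 'cV[R]_k.

(** Eliminating one entry between two elementary vectors of equal support leaves
a vector of smaller support, which has to vanish. *)
Lemma elementary_proportional g h i j : elementary W g -> elementary W h ->
  supp g = supp h -> i \in supp g -> g j 0 / g i 0 = h j 0 / h i 0.
Proof.
move=> [gW _ gmin] [hW _ _] gh ig; have ih : i \in supp h by rewrite -gh.
pose u := h i 0 *: g - g i 0 *: h.
have u0 : u = 0.
  apply/eqP; apply: contraT => u0.
  have uW : u \in W by rewrite memvB // memvZ.
  apply: contraNT (gmin _ uW u0) => _; apply/properP; split.
    apply/fintype.subsetP => t; rewrite [_ \in supp u]inE.
    apply: contraR => tg; have th : t \notin supp h by rewrite -gh.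
    move: tg th; rewrite !inE !negbK !mxE => /eqP -> /eqP ->.
    by rewrite !mulr0 subr0.
  by exists i => //; rewrite inE !mxE mulrC subrr eqxx.
have := congr1 (fun w : 'cV[R]_k => w j 0) u0; rewrite !mxE => /eqP.
rewrite subr_eq0 => /eqP e; move: ig ih; rewrite !inE => gi hi.
by apply: (mulIf gi); apply: (mulIf hi); rewrite divfK // mulrC e; field.
Qed.

(** By proportionality there is one ratio for each support and each pair of
indices, hence finitely many, and the supremum that defines the circuit
imbalance is an upper bound. *)
Lemma elementary_ratios_bounded : exists B : R, forall g i j,
  elementary W g -> i \in supp g -> `|g j 0 / g i 0| <= B.
Proof.
have : forall t : {set 'I_k} * 'I_k * 'I_k, exists B : R, 0 <= B /\
    forall g, elementary W g -> supp g = t.1.1 -> t.1.2 \in supp g ->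
      `|g t.2 0 / g t.1.2 0| <= B.
  move=> [[S i] j] /=.
  case: (pselect (exists g, [/\ elementary W g, supp g = S & i \in supp g])).
    move=> [g [eg gS ig]]; exists `|g j 0 / g i 0|; split => // h eh hS ih.
    by rewrite (elementary_proportional _ eh eg) // gS hS.
  by move=> no; exists 0; split => // g eg gS ig; case: no; exists g.
move=> /choice[f fP]; exists (\sum_t f t) => g i j eg ig.
have [_ /(_ g eg erefl ig)] := fP (supp g, i, j).
move=> /le_trans; apply; rewrite (bigD1 (supp g, i, j)) //= lerDl.
by apply: sumr_ge0 => t _; have [] := fP t.
Qed.

Hypotheses (W0 : W != 0%VS) (W1 : W != fullv).

Lemma ratio_le_circuit_imbalance g i j :
  elementary W g -> i \in supp g -> j \in supp g ->
  `|g j 0 / g i 0| <= circuit_imbalance W.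
Proof.
move=> eg ig jg; rewrite /circuit_imbalance (negbTE W0) (negbTE W1) /=.
apply: ub_le_sup; last by exists g, i, j.
have [B BP] := elementary_ratios_bounded.
by exists B => _ [h [s [t [eh sh _ ->]]]]; exact: BP.
Qed.

Lemma circuit_imbalance_ge1 : 1 <= circuit_imbalance W.
Proof.
have [v vW v0] : exists2 v, v \in W & v != 0.
  by exists (vpick W); rewrite ?memv_pick ?vpick0.
have [g eg _] := conforming_elementary vW v0; have [_ g0 _] := eg.
have /set0Pn[i ig] : supp g != finset.set0 by rewrite supp_eq0.
have := ratio_le_circuit_imbalance eg ig ig.
by rewrite divff ?normr1 //; move: ig; rewrite inE.
Qed.

Lemma elementary_entry_le g i j : elementary W g -> g i 0 != 0 ->
  `|g j 0| <= circuit_imbalance W * `|g i 0|.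
Proof.
move=> eg gi; have [->|gj] := eqVneq (g j 0) 0.
  by rewrite normr0 mulr_ge0 // (le_trans _ circuit_imbalance_ge1).
by rewrite -ler_pdivrMr ?normr_gt0 // -normf_div ratio_le_circuit_imbalance ?inE.
Qed.

End Imbalance.

Section ImbalanceXA.
Context {R : realType} {m n : nat} (A : 'M[R]_(m, n)).
Hypotheses (m0 : (0 < m)%N) (n0 : (0 < n)%N).
Implicit Types (h v : 'cV[R]_n).

Local Notation kappa := (circuit_imbalance (XA A)).

Lemma supp_col_mx h v (u w : 'cV[R]_m) :
  supp h \subset supp v -> supp u \subset supp w ->
  supp (col_mx h u) \subset supp (col_mx v w).
Proof.
move=> /fintype.subsetP hv /fintype.subsetP uw; apply/fintype.subsetP => t.
rewrite !inE; case: (split_ordP t) => s ->.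
  by rewrite !col_mxEu => hs; have := hv s; rewrite !inE; apply.
by rewrite !col_mxEd => us; have := uw s; rewrite !inE; apply.
Qed.

Lemma col_mx_neq0 h (u : 'cV[R]_m) : h != 0 -> col_mx h u != 0.
Proof.
by apply: contra => /eqP; rewrite -col_mx0 => /eq_col_mx[-> _].
Qed.

(** A vector of the space is determined by its first block, so a smaller support
would make that block a multiple of the unit vector. *)
Lemma elementary_column j :
  elementary (XA A) (col_mx (delta_mx j 0) (A *m delta_mx j 0)).
Proof.
have d0 : delta_mx j 0 != 0 :> 'cV[R]_n by rewrite -enorm_gt0 enorm_delta.
split; [by rewrite mem_XA | exact: col_mx_neq0 | move=> w wX w0].
apply/negP; move: (XA_colP wX); move: (usubmx w) => u wE pr.
have uE : u = u j 0 *: delta_mx j 0.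
  apply/colP => i; rewrite !mxE eqxx andbT.
  have [->|ij] := eqVneq i j; first by rewrite mulr1.
  rewrite mulr0; apply/eqP; apply: contraT => ui.
  have := fintype.subsetP (proper_sub pr) (lshift m i).
  rewrite wE !inE !col_mxEu ui => /(_ isT).
  by rewrite mxE (negbTE ij) /= eqxx.
move: w0 pr; rewrite wE uE -scalemxAr -scale_col_mx scaler_eq0 negb_or.
by case/andP => c0 _; rewrite suppZ // fintype.properxx.
Qed.

Lemma XA_neq0 : XA A != 0%VS.
Proof.
have [+ + _] := elementary_column (Ordinal n0).
by move=> gX; apply: contraNneq => X0; move: gX; rewrite X0 memv0.
Qed.

Lemma XA_neqfull : XA A != fullv.
Proof.
apply/eqP => Xf; have := memvf (col_mx 0 (delta_mx (Ordinal m0) 0) : 'cV[R]_(n + m)).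
rewrite -Xf mem_XA mulmx0 eq_sym => /eqP d0.
by have := enorm_delta (R := R) (Ordinal m0); rewrite d0 enorm0 => /eqP;
  rewrite eq_sym oner_eq0.
Qed.

Lemma kappa_ge1 : 1 <= kappa.
Proof. exact: circuit_imbalance_ge1 XA_neq0 XA_neqfull. Qed.

Lemma kappa_ge0 : 0 <= kappa.
Proof. exact: le_trans ler01 kappa_ge1. Qed.

Lemma entry_le_kappa i j : `|A i j| <= kappa.
Proof.
have := elementary_entry_le XA_neq0 XA_neqfull (i := lshift m j)
  (rshift n i) (elementary_column j).
rewrite col_mxEu col_mxEd -colE !mxE !eqxx normr1 mulr1; apply.
exact: oner_neq0.
Qed.

Lemma kappa_entry_ge1 i j : A i j != 0 -> 1 <= kappa * `|A i j|.
Proof.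
have := elementary_entry_le XA_neq0 XA_neqfull (i := rshift n i)
  (lshift m j) (elementary_column j).
by rewrite col_mxEu col_mxEd -colE !mxE !eqxx normr1.
Qed.

Lemma spectral_norm_le_kappa : (m <= n)%N -> spectral_norm A <= n%:R * kappa.
Proof.
move=> mn; apply: spectral_norm_le; first by rewrite mulr_ge0 ?kappa_ge0.
move=> v; apply: le_trans (enorm_mulmx_entries _ kappa_ge0 entry_le_kappa) _.
rewrite ler_wpM2r ?enorm_ge0 // ler_wpM2r ?kappa_ge0 //.
rewrite -[leRHS]ger0_norm // -sqrtr_sqr ler_wsqrtr // expr2.
by rewrite ler_wpM2r // ler_nat.
Qed.

Lemma kappa_column_ge1 j : col j A != 0 -> 1 <= kappa * enorm (col j A).
Proof.
rewrite -supp_eq0 => /set0Pn[i]; rewrite inE mxE => Aij.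
apply: le_trans (kappa_entry_ge1 Aij) _; rewrite ler_wpM2l ?kappa_ge0 //.
by have := coord_le_enorm (col j A) i; rewrite mxE.
Qed.

Lemma kappa_spectral_norm_ge1 : \rank A = m -> 1 <= kappa * spectral_norm A.
Proof.
move=> rA; have /matrix0Pn[i [j Aij]] : A != 0.
  by rewrite -mxrank_eq0 rA -lt0n.
apply: le_trans (kappa_entry_ge1 Aij) _; rewrite ler_wpM2l ?kappa_ge0 //.
exact: entry_le_spectral_norm.
Qed.

Lemma kernel_vector (S : {set 'I_n}) : (m < #|S|)%N ->
  exists u : 'cV[R]_n, [/\ u != 0, A *m u = 0 & supp u \subset S].
Proof.
move=> mS.
(* [E] embeds the row vectors indexed by [S]. *)
pose E : 'M[R]_(#|S|, n) := \matrix_(a, j) (enum_val a == j)%:R.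
set c := nz_row (kermx (E *m A^T)).
have c0 : c != 0.
  by rewrite nz_row_eq0 -mxrank_eq0 mxrank_ker subn_eq0 -ltnNge
             (leq_ltn_trans (rank_leq_col _)).
have cE : c *m (E *m A^T) = 0.
  by apply/eqP; rewrite -sub_kermx nz_row_sub.
exists (c *m E)^T; split.
- have [a ca] : exists a, c 0 a != 0.
    by move/matrix0Pn: c0 => [i [a]]; rewrite ord1; exists a.
  apply: contraNneq ca => /colP /(_ (enum_val a)); rewrite !mxE.
  move=> <-; rewrite (bigD1 a) //= big1 ?addr0 ?mxE ?eqxx ?mulr1 // => b ba.
  by rewrite mxE (inj_eq enum_val_inj) (negbTE ba) mulr0.
- by rewrite -[A]trmxK -trmx_mul -mulmxA cE trmx0.
- apply/fintype.subsetP => j; rewrite inE !mxE; apply: contraR => jS.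
  rewrite big1 // => a _; rewrite mxE; case: eqP => [aj|]; rewrite ?mulr0 //.
  by move: jS; rewrite -aj enum_valP.
Qed.

(** The columns in the support of an outer elementary vector are independent:
a dependency would be an element of the space of smaller support. *)
Lemma card_supp_outer h : elementary (XA A) (col_mx h (A *m h)) ->
  A *m h != 0 -> (#|supp h| <= m)%N.
Proof.
move=> [_ _ hmin] Ah; rewrite leqNgt; apply/negP => /kernel_vector[u [u0 Au uh]].
have uX : col_mx u 0 \in XA A by rewrite mem_XA Au.
have /negP := hmin _ uX (col_mx_neq0 _ u0); apply; apply/properP; split.
  by apply: supp_col_mx => //; apply/fintype.subsetP => i; rewrite inE mxE eqxx.
have /set0Pn[i] : supp (A *m h) != finset.set0 by rewrite supp_eq0.
by rewrite inE => Ahi; exists (rshift n i); rewrite inE col_mxEd // mxE eqxx.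
Qed.

(** Each of the at most [m] entries of [h] is bounded by [kappa] times any nonzero
entry of [A *m h]. *)
Lemma enorm_outer h : elementary (XA A) (col_mx h (A *m h)) -> A *m h != 0 ->
  enorm h <= Num.sqrt m%:R * kappa * \sum_i `|(A *m h) i 0|.
Proof.
move=> eh Ah; rewrite -mulrA.
have s0 : 0 <= \sum_i `|(A *m h) i 0| by apply: sumr_ge0.
have /set0Pn[i] : supp (A *m h) != finset.set0 by rewrite supp_eq0.
rewrite inE => Ahi; apply: le_trans (_ : Num.sqrt #|supp h|%:R * _ <= _).
  apply: (@enorm_le_card _ _ h (supp h) (kappa * \sum_i `|(A *m h) i 0|)) => //.
    by rewrite mulr_ge0 ?kappa_ge0.
  move=> j; have := elementary_entry_le XA_neq0 XA_neqfull (i := rshift n i)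
    (lshift m j) eh.
  rewrite col_mxEu col_mxEd => /(_ Ahi) /le_trans; apply.
  rewrite ler_wpM2l ?kappa_ge0 // (bigD1 i) //= lerDl.
  by apply: sumr_ge0.
rewrite ler_wpM2r ?mulr_ge0 ?kappa_ge0 // ler_wsqrtr // ler_nat.
exact: card_supp_outer.
Qed.

Lemma norm_same_sign (x y : R) : 0 < x * y -> `|y| = Num.sg x * y.
Proof.
case: (ltrgt0P x) => [x0|x0|->]; last by rewrite mul0r ltxx.
  by rewrite pmulr_rgt0 // => y0; rewrite gtr0_sg // mul1r gtr0_norm.
by rewrite nmulr_rgt0 // => y0; rewrite ltr0_sg // mulN1r ltr0_norm.
Qed.

(** Conforming vectors add up without cancellation, so the estimate for one
outer elementary vector passes to their sum.  The 1-norm of the images costs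
the second factor [Num.sqrt m]. *)
Lemma enorm_outer_sum v l (h : 'I_l -> 'cV[R]_n) (P : pred 'I_l) :
  path_circuit_decomposition A v h -> (forall k, P k -> A *m h k != 0) ->
  enorm (\sum_(k | P k) h k) <=
    m%:R * kappa * enorm (A *m \sum_(k | P k) h k).
Proof.
move=> [_ _ hP] outer; set u := \sum_(k | P k) h k.
apply: le_trans (enorm_sum _ _ _) _.
apply: (@le_trans _ _ (\sum_(k | P k)
  Num.sqrt m%:R * kappa * \sum_i `|(A *m h k) i 0|)).
  by apply: ler_sum => k Pk; apply: enorm_outer (outer k Pk); have [] := hP k.
rewrite -big_distrr /= exchange_big /=.
apply: (@le_trans _ _ (Num.sqrt m%:R * kappa * \sum_i `|(A *m u) i 0|)).
  rewrite ler_wpM2l ?mulr_ge0 ?sqrtr_ge0 ?kappa_ge0 // ler_sum // => i _.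
  pose s := Num.sg ((A *m v) i 0).
  have sE k : P k -> `|(A *m h k) i 0| = s * (A *m h k) i 0.
    move=> Pk; have [_ /(_ (rshift n i))] := hP k; rewrite !col_mxEd /s.
    have [->|hi] := eqVneq ((A *m h k) i 0) 0; first by move=> _; rewrite normr0 mulr0.
    by move=> /(_ isT); exact: norm_same_sign.
  rewrite (eq_bigr _ sE) -big_distrr /= /u mulmx_sumr summxE.
  apply: le_trans (ler_norm _) _; rewrite normrM.
  by rewrite ler_piMl // /s normr_sg; case: eqP.
have -> : m%:R * kappa * enorm (A *m u) =
          Num.sqrt m%:R * kappa * (Num.sqrt m%:R * enorm (A *m u)).
  by rewrite -[m%:R in LHS]sqr_sqrtr ?ler0n //; ring.
by rewrite ler_wpM2l ?mulr_ge0 ?sqrtr_ge0 ?kappa_ge0 // sum_norm_le_enorm.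
Qed.

Lemma cycle_free_enorm v : cycle_free A v ->
  enorm v <= m%:R * kappa * enorm (A *m v).
Proof.
have [l [h hd]] := path_circuit_decomposition_exists A v.
move=> /(_ l h hd) cf; have [_ -> _] := hd; apply: enorm_outer_sum hd _ => k _.
by apply/eqP; exact: cf.
Qed.

(** Dropping the inner vectors of a decomposition keeps the image under [A], and
by conformity the result lies between 0 and [v] in each coordinate.  So if [x]
and [x + v] are nonnegative, the shorter step [u] also stays nonnegative. *)
Lemma remove_inner v : exists u : 'cV[R]_n,
  [/\ A *m u = A *m v, enorm u <= m%:R * kappa * enorm (A *m u)
    & forall i, 0 <= u i 0 \/ v i 0 <= u i 0].
Proof.
have [l [h hd]] := path_circuit_decomposition_exists A v.
have [_ vE hP] := hd; pose P k := A *m h k != 0.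
exists (\sum_(k | P k) h k); split.
- rewrite [in RHS]vE [in RHS](bigID P) /= mulmxDr [X in _ + X](_ : _ = 0) ?addr0 //.
  by rewrite mulmx_sumr big1 // => k; rewrite negbK => /eqP.
- exact: enorm_outer_sum hd _.
- move=> i; have hi k : h k i 0 != 0 -> 0 < v i 0 * h k i 0.
    by move=> hk; have [_ /(_ (lshift m i))] := hP k; rewrite !col_mxEu; apply.
  have [vi|vi] := leP 0 (v i 0); [left|right].
    rewrite summxE sumr_ge0 // => k _; have [->//|/hi pos] := eqVneq (h k i 0) 0.
    move: vi; rewrite le_eqVlt => /orP[/eqP v0|vi].
      by move: pos; rewrite -v0 mul0r ltxx.
    by move: pos; rewrite pmulr_rgt0 // => /ltW.
  rewrite [in leLHS]vE !summxE [leLHS](bigID P) /= gerDl.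
  rewrite sumr_le0 // => k _; have [->//|/hi] := eqVneq (h k i 0) 0.
  by rewrite nmulr_rgt0 // => /ltW.
Qed.

End ImbalanceXA.

(** * Minor cycles and the optimality gap *)

Section Method.
Context {R : realType} {m n : nat} (A : 'M[R]_(m, n)) (b : 'cV[R]_m).
Implicit Types (x y u w z : 'cV[R]_n).

Definition cost x : R := enorm (A *m x - b) ^+ 2.

Lemma dot_gradient x u :
  dot (A *m x - b) (A *m u) = dot (gradient A b x) u.
Proof. by rewrite dotC dot_mulmx dotC. Qed.

Lemma costD x u :
  cost (x + u) = cost x + 2 * dot (gradient A b x) u + enorm (A *m u) ^+ 2.
Proof.
rewrite /cost mulmxDr addrAC -dot_gradient; move: (A *m x - b) (A *m u) => r v.
by rewrite !enorm_sqr !dotDl !dotDr (dotC v r); ring.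
Qed.

Lemma slope_ge0 (d e : R) : 0 <= e ->
  (forall t, 0 < t -> 0 <= 2 * (t * d) + t ^+ 2 * e) -> 0 <= d.
Proof.
move=> e0 h; rewrite leNgt; apply/negP => d0.
have e1 : 0 < e + 1 by lra.
(* Near the minimizer [- d / e] of the parabola, but defined for [e = 0] too. *)
have t0 : 0 < - d / (e + 1) by rewrite divr_gt0 // oppr_gt0.
have := h _ t0; rewrite leNgt => /negP; apply.
have -> : 2 * (- d / (e + 1) * d) + (- d / (e + 1)) ^+ 2 * e =
          - (d ^+ 2 * (e + 2) / (e + 1) ^+ 2) by field; rewrite gt_eqF.
have d2 : 0 < d ^+ 2 by rewrite exprn_even_gt0 //= lt_eqF.
rewrite oppr_lt0; apply: divr_gt0; last exact: exprn_gt0.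
by apply: mulr_gt0 => //; lra.
Qed.

(** First-order optimality on the subspace of vectors supported by [x]. *)
Lemma centroid_gradient x w u : in_centroid_set A b x w ->
  (forall i, x i 0 = 0 -> u i 0 = 0) -> dot (gradient A b w) u = 0.
Proof.
move=> [wx wmin].
have le0 (v : 'cV[R]_n) : (forall i, x i 0 = 0 -> v i 0 = 0) ->
    0 <= dot (gradient A b w) v.
  move=> vx; apply: (@slope_ge0 _ (enorm (A *m v) ^+ 2)) => [|t _].
    exact: sqr_ge0.
  have : cost w <= cost (w + t *: v).
    rewrite /cost ler_pXn2r ?nnegrE ?enorm_ge0 //; apply: wmin => i xi.
    by rewrite !mxE wx // vx // mulr0 addr0.
  rewrite costD dotZr -scalemxAr enormZ exprMn real_normK ?num_real //; lra.
move=> ux; apply/eqP; rewrite eq_le le0 // andbT -oppr_ge0 -dotNr le0 //.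
by move=> i xi; rewrite mxE ux // oppr0.
Qed.

Variable Psi : 'cV[R]_n -> 'cV[R]_n.
Hypothesis PsiP : cycle_free_centroid_mapping A b Psi.

Definition stable x : Prop := nonneg x /\ Psi x = x.

Lemma Psi_centroid x : nonneg x -> in_centroid_set A b x (Psi x).
Proof. by move=> /PsiP.1[]. Qed.

Lemma stable_cost_le x y : stable x -> supp y \subset supp x -> cost x <= cost y.
Proof.
move=> [x0 xE] /fintype.subsetP yx; have [_] := Psi_centroid x0; rewrite xE => h.
rewrite /cost ler_pXn2r ?nnegrE ?enorm_ge0 //; apply: h => i xi.
apply/eqP; apply: contraT => yi.
by have := yx i; rewrite !in_supp yi xi eqxx => /(_ isT).
Qed.

Lemma stable_gradient x i : stable x -> x i 0 != 0 -> gradient A b x i 0 = 0.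
Proof.
move=> [x0 xE] xi; rewrite -dot_delta.
apply: (@centroid_gradient x); first by rewrite -{2}xE; exact: Psi_centroid.
move=> j xj; rewrite mxE; case: eqP => // ji.
by move: xi; rewrite -ji xj eqxx.
Qed.

Lemma zero_stable : stable 0.
Proof.
have n0 : nonneg (0 : 'cV[R]_n) by move=> i; rewrite mxE.
split => //; have [h _] := Psi_centroid n0; apply/colP => i.
by rewrite [RHS]mxE h // mxE.
Qed.

(** If the full step to [w] is infeasible, the smallest ratio
[x i / (x i - w i)] over the negative entries of [w] is the largest step. *)
Lemma largest_step x w : nonneg x -> (forall i, x i 0 = 0 -> w i 0 = 0) ->
  exists a, [/\ 0 <= a <= 1, nonneg (x + a *: (w - x)),
    forall a', 0 <= a' <= 1 -> nonneg (x + a' *: (w - x)) -> a' <= a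
    & a = 1 \/ exists2 i, x i 0 != 0 & (x + a *: (w - x)) i 0 = 0].
Proof.
move=> x0 wx; case: (pselect (nonneg w)) => [w0|].
  exists 1; rewrite scale1r addrC subrK ler01 lexx; split => //; last by left.
  by move=> a' /andP[].
move=> /existsNP[i0 /negP]; rewrite -ltNge => wi0.
case: (@arg_minP _ _ _ i0 (fun i => w i 0 < 0)
  (fun i => x i 0 / (x i 0 - w i 0)) wi0) => i wi imin.
have xw j : w j 0 < 0 -> 0 < x j 0 - w j 0 by have := x0 j; lra.
set a := x i 0 / (x i 0 - w i 0) in imin *.
have aE : a * (x i 0 - w i 0) = x i 0 by rewrite /a divfK // gt_eqF // xw.
have a0 : 0 <= a by rewrite divr_ge0 // ltW // xw.
have a1 : a <= 1 by rewrite ler_pdivrMr ?xw // mul1r; lra.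
exists a; split; first by rewrite a0.
- move=> j; rewrite !mxE; have [wj|wj] := leP 0 (w j 0).
    by have := x0 j; nra.
  by have := imin j wj; rewrite ler_pdivlMr ?xw //; lra.
- move=> a' _ /(_ i); rewrite !mxE => h.
  by rewrite /a ler_pdivlMr ?xw //; lra.
- right; exists i; last by rewrite !mxE; lra.
  by apply: contraTneq wi => /wx ->; rewrite ltxx.
Qed.

Lemma minor_cycle_exists x : nonneg x -> exists y, minor_cycle Psi x y.
Proof.
move=> x0; have [wx _] := Psi_centroid x0.
have [a [a01 xa amax _]] := largest_step x0 wx.
exists (x + a *: (Psi x - x)), a; split => // a' [a'01 xa']; exact: amax.
Qed.

Lemma minor_cycle_support x y : nonneg x -> minor_cycle Psi x y ->
  [/\ nonneg y, supp y \subset supp x & stable y \/ supp y \proper supp x].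
Proof.
move=> x0 [a [[a01 xa] amax yE]]; have [wx _] := Psi_centroid x0.
have [a' [a'01 xa' a'max a'P]] := largest_step x0 wx.
have aE : a = a'.
  by apply/eqP; rewrite eq_le a'max // amax.
have yx : supp y \subset supp x.
  apply/fintype.subsetP => i; rewrite !in_supp; apply: contraNneq => xi.
  by rewrite yE !mxE wx xi // subrr mulr0 addr0.
rewrite -yE in xa; split => //; case: a'P => [a1|[i xi yi]].
  left; split => //; have -> : y = Psi x.
    by rewrite yE aE a1 scale1r addrC subrK.
  have [_] := PsiP.1 x x0; apply.
  by move: xa; rewrite yE aE a1 scale1r addrC subrK.
right; apply/properP; split => //; exists i; rewrite in_supp //.
by rewrite yE aE yi eqxx.
Qed.

Hypotheses (m0 : (0 < m)%N) (n0 : (0 < n)%N).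

Local Notation kappa := (circuit_imbalance (XA A)).

(** The Hoffman-type constant that bounds a cycle-free vector by its image. *)
Definition proximity : R := m%:R * kappa.

Lemma proximity_ge_kappa : kappa <= proximity.
Proof. by rewrite ler_peMl ?kappa_ge0 // ler1n. Qed.

Lemma proximity_ge1 : 1 <= proximity.
Proof. exact: le_trans (kappa_ge1 A m0 n0) proximity_ge_kappa. Qed.

Lemma proximity_ge0 : 0 <= proximity.
Proof. exact: le_trans ler01 proximity_ge1. Qed.

(** By Pythagoras around the centroid, the squared length of the step under [A]
is at most the decrease of the cost; cycle-freeness turns this into a bound on
the step itself. *)
Lemma minor_cycle_decrease x y : nonneg x -> minor_cycle Psi x y ->
  enorm (y - x) ^+ 2 <= proximity ^+ 2 * (cost x - cost y).
Proof.
move=> x0 [a [[/andP[a0 a1] _] _ ->]]; set w := Psi x.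
have orth (v : 'cV[R]_n) : (forall i, x i 0 = 0 -> v i 0 = 0) ->
    dot (gradient A b w) v = 0.
  by move=> vx; apply: (@centroid_gradient x) => //; exact: Psi_centroid.
have wx i : x i 0 = 0 -> (w - x) i 0 = 0.
  by move=> xi; have [h _] := Psi_centroid x0; rewrite !mxE h // xi subrr.
have costE t : cost (x + t *: (w - x)) =
    cost w + (1 - t) ^+ 2 * enorm (A *m (w - x)) ^+ 2.
  have -> : x + t *: (w - x) = w + (t - 1) *: (w - x).
    by apply/colP => i; rewrite !mxE; ring.
  rewrite costD dotZr orth // mulr0 mulr0 addr0 -scalemxAr enormZ exprMn.
  by rewrite real_normK ?num_real // -sqrrN opprB.
have -> : cost x = cost (x + 0 *: (w - x)) by rewrite scale0r addr0.
rewrite !costE addrC addKr enormZ ger0_norm // exprMn.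
have cf := cycle_free_enorm m0 n0 (PsiP.2 x x0).
rewrite -/w -/proximity in cf.
have : enorm (w - x) ^+ 2 <= (proximity * enorm (A *m (w - x))) ^+ 2.
  by rewrite ler_pXn2r ?nnegrE ?(mulr_ge0 proximity_ge0) ?enorm_ge0.
rewrite exprMn; set P := proximity ^+ 2; set e := enorm (A *m _) ^+ 2 => h.
have P0 : 0 <= P * e by rewrite mulr_ge0 ?sqr_ge0.
apply: (@le_trans _ _ (a ^+ 2 * (P * e))); first by rewrite ler_wpM2l ?sqr_ge0.
rewrite -subr_ge0 (_ : _ - _ = 2 * a * (1 - a) * (P * e)); last by ring.
apply: mulr_ge0 => //; apply: mulr_ge0; last by rewrite subr_ge0.
exact: mulr_ge0.
Qed.

Lemma minor_cycle_cost x y : nonneg x -> minor_cycle Psi x y ->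
  cost y <= cost x.
Proof.
move=> x0 /(minor_cycle_decrease x0) h.
have : 0 <= proximity ^+ 2 * (cost x - cost y) by apply: le_trans h; rewrite sqr_ge0.
by rewrite pmulr_rge0 ?subr_ge0 // exprn_gt0 // (lt_le_trans _ proximity_ge1).
Qed.

(** Minor cycles do not increase the cost and end when the support cannot shrink
any more. *)
Lemma stabilize y : nonneg y -> exists2 x, stable x & cost x <= cost y.
Proof.
have [c] := ubnP #|supp y|; elim: c y => // c IH y yc y0.
have [u yu] := minor_cycle_exists y0.
have uy := minor_cycle_cost y0 yu.
have [u0 _ [us|pr]] := minor_cycle_support y0 yu; first by exists u.
have [|x xs xu] := IH u _ u0; last by exists x => //; exact: le_trans uy.
by apply: leq_trans (proper_card pr) _; rewrite -ltnS.
Qed.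

(** The cost of a stable point depends on its support only, so stable points
take finitely many costs; and every feasible point is dominated by a stable
one. *)
Lemma optimum_exists : exists2 x, stable x & forall y, nonneg y -> cost x <= cost y.
Proof.
have same x y : stable x -> stable y -> supp x = supp y -> cost x = cost y.
  by move=> xs ys xy; apply/eqP; rewrite eq_le !stable_cost_le ?xy.
have /choice[f fP] : forall S : {set 'I_n}, exists c, forall x,
    stable x -> supp x = S -> cost x = c.
  move=> S; case: (pselect (exists2 x, stable x & supp x = S)) => [[x xs xS]|no].
    by exists (cost x) => y ys yS; apply: same; rewrite ?xS.
  by exists 0 => y ys yS; case: no; exists y.
pose P S := `[< exists2 x, stable x & supp x = S >].
have P0 : P (supp (0 : 'cV[R]_n)) by apply/asboolP; exists 0 => //; exact: zero_stable.
case: (@arg_minP _ _ _ _ P f P0) => S /asboolP[x xs xS] fmin.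
exists x => // y /stabilize[u us uy]; apply: le_trans uy.
rewrite (fP _ _ xs xS) (fP _ _ us erefl); apply: fmin.
by apply/asboolP; exists u.
Qed.

Variable xs : 'cV[R]_n.
Hypotheses (xs_stable : stable xs) (xs_min : forall y, nonneg y -> cost xs <= cost y).

Definition gap x : R := cost x - cost xs.

Lemma gap_ge0 x : nonneg x -> 0 <= gap x.
Proof. by move=> /xs_min; rewrite subr_ge0. Qed.

Lemma gap_optimal x : nonneg x -> gap x <= 0 -> optimal A b x.
Proof.
move=> x0 gx; split => // y /xs_min yx; rewrite -/(cost x) -/(cost y).
by move: gx; rewrite /gap; lra.
Qed.

Lemma optimal_gradient_ge0 i : 0 <= gradient A b xs i 0.
Proof.
rewrite -dot_delta; apply: slope_ge0 (sqr_ge0 (enorm (A *m delta_mx i 0))) _.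
move=> t t0; have : cost xs <= cost (xs + t *: delta_mx i 0).
  apply: xs_min => j; rewrite !mxE; have := xs_stable.1 j.
  by case: eqP => _ /=; rewrite ?mulr0 ?mulr1; lra.
rewrite costD dotZr -scalemxAr enormZ exprMn real_normK ?num_real //; lra.
Qed.

(** The linear term has no part along [xs]: the gradient at the stable point [xs]
vanishes on its support. *)
Lemma gapE x :
  gap x = enorm (A *m (x - xs)) ^+ 2 + 2 * dot (gradient A b xs) x.
Proof.
have gx0 : dot (gradient A b xs) xs = 0.
  rewrite /dot big1 // => i _; have [->|xi] := eqVneq (xs i 0) 0.
    by rewrite mulr0.
  by rewrite stable_gradient ?mul0r.
have xE : x = xs + (x - xs) by rewrite addrC subrK.
by rewrite /gap {1}xE costD dotDr dotNr gx0; ring.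
Qed.

Lemma optimal_gradient_dot_ge0 x : nonneg x -> 0 <= dot (gradient A b xs) x.
Proof.
by move=> x0; apply: sumr_ge0 => i _; rewrite mulr_ge0 ?optimal_gradient_ge0.
Qed.

Lemma image_dist_le_gap x : nonneg x -> enorm (A *m (x - xs)) ^+ 2 <= gap x.
Proof.
by move=> x0; have := optimal_gradient_dot_ge0 x0; rewrite gapE; lra.
Qed.

Lemma descent_ge0 x : nonneg (descent A b x).
Proof. by move=> i; rewrite mxE le_max lexx orbT. Qed.

Lemma dot_descent x :
  dot (gradient A b x) (descent A b x) = - enorm (descent A b x) ^+ 2.
Proof.
rewrite enorm_sqr /dot -sumrN; apply: eq_bigr => i _.
by rewrite [descent A b x i 0]mxE maxEle; case: ifP => _; ring.
Qed.

Lemma descentE x i : 0 < descent A b x i 0 ->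
  gradient A b x i 0 = - descent A b x i 0.
Proof.
by rewrite [descent A b x i 0]mxE maxEle; case: ifP => _; rewrite ?opprK ?ltxx.
Qed.

(** Expand the cost from [x] to an optimal point [x + u], which is near [x] because
inner vectors can be removed.  Coordinates where [x] is positive do not
contribute to the slope, the gradient of a stable point being zero there; in the
others [u] is nonnegative, and only the descent vector matters. *)
Lemma gap_le_descent x : stable x ->
  gap x <= 2 * (enorm (descent A b x) *
                (proximity * enorm (A *m (x - xs)))) - enorm (A *m (x - xs)) ^+ 2.
Proof.
move=> xst; have [u [Au un uP]] := remove_inner A m0 n0 (xs - x).
have AuN : enorm (A *m u) = enorm (A *m (x - xs)).
  by rewrite Au -opprB mulmxN enormN.
have cE : cost xs = cost (x + u).
  by rewrite /cost mulmxDr Au -mulmxDr [x + _]addrC subrK.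
rewrite /gap cE costD -AuN.
have : - dot (gradient A b x) u <= enorm (descent A b x) * (proximity * enorm (A *m u)).
  apply: le_trans (_ : dot (descent A b x) u <= _).
    rewrite -sumrN; apply: ler_sum => i _; rewrite -mulNr [in leRHS]mxE.
    have [xi|xi] := eqVneq (x i 0) 0; last first.
      by rewrite stable_gradient // oppr0 maxxx.
    rewrite ler_wpM2r // ?le_max ?lexx //.
    have [//|] := uP i; apply: le_trans; rewrite !mxE xi subr0.
    exact: xs_stable.1.
  apply: le_trans (cauchy_schwarz _ _) _.
  by rewrite ler_wpM2l ?enorm_ge0.
lra.
Qed.

Lemma gap_le_descent_sqr x : stable x ->
  gap x <= proximity ^+ 2 * enorm (descent A b x) ^+ 2.
Proof.
move=> /gap_le_descent; set d := enorm (A *m _); set z := enorm _ => h.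
by have := sqr_ge0 (z * proximity - d); rewrite sqrrB exprMn; nra.
Qed.

(** A nonnegative gap forces the quadratic term of the previous estimate to be
dominated by the linear one. *)
Lemma image_dist_le_descent x : stable x ->
  enorm (A *m (x - xs)) <= 2 * (proximity * enorm (descent A b x)).
Proof.
move=> xst; have := gap_le_descent xst; have := gap_ge0 xst.1.
set d := enorm (A *m _); set z := enorm _ => g0 h.
have [->|d0] := eqVneq d 0.
  by rewrite mulr_ge0 // (mulr_ge0 proximity_ge0 (enorm_ge0 _)).
have dp : 0 < d by rewrite lt_def d0 enorm_ge0.
by rewrite -(ler_pM2l dp); nra.
Qed.

Lemma descent0_optimal x : stable x -> descent A b x = 0 -> gap x <= 0.
Proof.
by move=> /gap_le_descent_sqr + z0; rewrite z0 enorm0 expr0n mulr0.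
Qed.

End Method.

(** * The updates *)

Section Updates.
Context {R : realType} {m n : nat} (A : 'M[R]_(m, n)) (b : 'cV[R]_m).
Context (Psi : 'cV[R]_n -> 'cV[R]_n) (PsiP : cycle_free_centroid_mapping A b Psi).
Context (m0 : (0 < m)%N) (n0 : (0 < n)%N) (xs : 'cV[R]_n) (xs_stable : stable Psi xs).
Context (xs_min : forall y, nonneg y -> cost A b xs <= cost A b y).
Implicit Types (x y z : 'cV[R]_n).

Local Notation gap := (gap A b xs).
Local Notation proximity := (proximity A).

(** All that the count of cycles uses of an update; [1 / D] is the rate of
convergence. *)
Record decreasing_update (update : 'cV[R]_n -> 'cV[R]_n -> Prop) (a : nat)
    (D : R) : Prop := {
  update_exists : forall x, exists y, update x y;
  update_optimal : forall x, stable Psi x -> gap x <= 0 -> update x x;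
  update_step : forall x y, stable Psi x -> update x y ->
    [/\ nonneg y, (#|supp y| <= #|supp x| + a)%N,
        gap x <= D * (gap x - gap y) &
        forall i, `|y i 0 - x i 0| <= 2 * (proximity * Num.sqrt (gap x))] }.

(** A point of no gap is optimal itself, so its gradient is nonnegative. *)
Lemma gap0_descent x : stable Psi x -> gap x <= 0 -> descent A b x = 0.
Proof.
move=> xst gx; apply/colP => i; rewrite [LHS]mxE [RHS]mxE.
apply/max_idPr; rewrite oppr_le0; apply: optimal_gradient_ge0 xst _ _ => y y0.
by apply: le_trans (xs_min y0); rewrite -subr_le0.
Qed.

(** At an optimal point the update is the identity, which meets the requirements
of a step. *)
Lemma optimal_update_step x (a : nat) D : stable Psi x -> descent A b x = 0 ->
  [/\ nonneg x, (#|supp x| <= #|supp x| + a)%N,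
      gap x <= D * (gap x - gap x) &
      forall i, `|x i 0 - x i 0| <= 2 * (proximity * Num.sqrt (gap x))].
Proof.
move=> xst z0; split; first exact: xst.1.
- exact: leq_addr.
- by rewrite subrr mulr0 (descent0_optimal PsiP).
- move=> i; rewrite subrr normr0.
  by rewrite mulr_ge0 // (mulr_ge0 (proximity_ge0 A m0 n0)) ?sqrtr_ge0.
Qed.

Lemma image_dist_le_sqrt_gap x : nonneg x ->
  enorm (A *m (x - xs)) <= Num.sqrt (gap x).
Proof.
move=> x0; rewrite -[leLHS]ger0_norm ?enorm_ge0 // -sqrtr_sqr ler_wsqrtr //.
exact: image_dist_le_gap PsiP _ _ _ _ _.
Qed.

(** The step is an exact line search and lowers the cost by [|z|^4 / |Az|^2].  Its
length [|z|^3 / |Az|^2] is controlled through [|z|^2 <= |A(x - xs)| * |Az|]: the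
gradient at [xs] is nonnegative, so only the change of the gradient between [xs]
and [x] can make [z] a descent direction. *)
Lemma projected_gradient_decreasing :
  decreasing_update (projected_gradient_update A b) n
    (proximity ^+ 2 * spectral_norm A ^+ 2).
Proof.
split.
- by move=> x; rewrite /projected_gradient_update; case: eqP => _; eexists.
- move=> x xst gx.
  by rewrite /projected_gradient_update (gap0_descent xst gx) eqxx.
move=> x y xst; rewrite /projected_gradient_update.
case: eqP => [z0 ->|/eqP z0]; first exact: optimal_update_step.
have P0 := proximity_ge0 A m0 n0; have S0 := spectral_norm_ge0 A.
have BSZ := enorm_mulmx_le A (descent A b x).
have gP := gap_le_descent_sqr PsiP m0 n0 xs_stable xst.
have dP := image_dist_le_descent PsiP m0 n0 xs_stable xs_min xst.
have zz := dot_descent A b x.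
have z_ge0 := descent_ge0 A b x.
move: (descent A b x) z0 BSZ gP dP zz z_ge0 => z z0 BSZ gP dP zz z_ge0 ->.
have Z0 : 0 < enorm z by rewrite enorm_gt0.
set d := enorm (A *m (x - xs)) in dP *.
have d0 : 0 <= d by exact: enorm_ge0.
have ZdB : enorm z ^+ 2 <= d * enorm (A *m z).
  have -> : enorm z ^+ 2 = - dot (A *m (x - xs)) (A *m z) - dot (gradient A b xs) z.
    rewrite -[LHS]opprK -zz -!dot_gradient -opprD -dotDl; congr (- dot _ _).
    by rewrite mulmxBr addrA subrK.
  have := optimal_gradient_dot_ge0 xs_stable xs_min z_ge0.
  have := cauchy_schwarz (- (A *m (x - xs))) (A *m z).
  by rewrite enormN dotNl -/d; lra.
have B0 : 0 < enorm (A *m z).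
  rewrite lt_def enorm_ge0 andbT; apply/eqP => B0.
  by move: ZdB; rewrite B0 mulr0 leNgt exprn_gt0.
have costE : cost A b (x + (enorm z ^+ 2 / enorm (A *m z) ^+ 2) *: z) =
    cost A b x - enorm z ^+ 4 / enorm (A *m z) ^+ 2.
  rewrite costD dotZr zz -scalemxAr enormZ exprMn real_normK ?num_real //.
  by field; rewrite gt_eqF.
split.
- move=> i; rewrite !mxE addr_ge0 ?(xst.1 i) // mulr_ge0 ?(z_ge0 i) //.
  by rewrite divr_ge0 ?sqr_ge0.
- apply: (@leq_trans #|'I_n|)%N; [exact: max_card | by rewrite card_ord leq_addl].
- rewrite {2 3}/gap costE.
  have -> : cost A b x - cost A b xs -
    (cost A b x - enorm z ^+ 4 / enorm (A *m z) ^+ 2 - cost A b xs) =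
    enorm z ^+ 4 / enorm (A *m z) ^+ 2 by ring.
  apply: le_trans gP _.
  rewrite (_ : _ * (_ / _) = proximity ^+ 2 * enorm z ^+ 2 *
    ((spectral_norm A * enorm z) ^+ 2 / enorm (A *m z) ^+ 2)); last by ring.
  rewrite ler_peMr ?(mulr_ge0 (sqr_ge0 _) (sqr_ge0 _)) // ler_pdivlMr ?exprn_gt0 // mul1r.
  by rewrite ler_pXn2r ?nnegrE ?(mulr_ge0 S0) // ltW.
- move=> i; rewrite !mxE [_ + _ * _]addrC addrK normrM ger0_norm; last first.
    by rewrite divr_ge0 ?sqr_ge0.
  apply: (@le_trans _ _ (2 * (proximity * d))); last first.
    rewrite ler_wpM2l // ler_wpM2l //; exact: image_dist_le_sqrt_gap xst.1.
  apply: (@le_trans _ _ (enorm z ^+ 2 / enorm (A *m z) ^+ 2 * enorm z)).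
    by rewrite ler_wpM2l ?coord_le_enorm // divr_ge0 ?sqr_ge0.
  rewrite mulrAC ler_pdivrMr ?exprn_gt0 // -(ler_pM2r Z0).
  have z2 := sqr_ge0 (enorm z).
  have := ler_pM z2 z2 ZdB ZdB.
  have : d * (d * enorm (A *m z) ^+ 2) <=
         2 * (proximity * enorm z) * (d * enorm (A *m z) ^+ 2).
    by rewrite ler_wpM2r // mulr_ge0 ?sqr_ge0.
  lra.
Qed.

(** An exact line search again, as the chosen coordinate of [x] is zero.  It lowers
the cost by [z j ^ 2 / |A^j|^2], and the largest entry of [z] carries at least
the fraction [1 / n] of [|z|^2].  Since [1 <= kappa * |A^j|], the step length is
at most [kappa] times the square root of the decrease. *)
Lemma coordinate_decreasing :
  decreasing_update (coordinate_update A b) 1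
    (n%:R * (proximity ^+ 2 * spectral_norm A ^+ 2)).
Proof.
have P0 := proximity_ge0 A m0 n0; have S0 := spectral_norm_ge0 A.
split.
- move=> x; rewrite /coordinate_update; case: eqP => _; first by exists x.
  pose f j := descent A b x j 0.
  case: (@arg_maxP _ _ _ (Ordinal n0) xpredT f isT) => j _ jP.
  by eexists; exists j; split; [move=> k; exact: jP | reflexivity].
- move=> x xst gx.
  by rewrite /coordinate_update (gap0_descent xst gx) eqxx.
move=> x y xst; rewrite /coordinate_update.
case: eqP => [z0 ->|/eqP z0]; first exact: optimal_update_step.
move=> [j [jmax ->]].
have z_ge0 := descent_ge0 A b x.
have zj : 0 < descent A b x j 0.
  rewrite lt_def z_ge0 andbT; apply: contraNneq z0 => zj.
  apply/eqP/colP => k; rewrite [RHS]mxE; apply/eqP.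
  by rewrite eq_le z_ge0 andbT -zj jmax.
have gj := descentE zj.
have xj : x j 0 = 0.
  apply/eqP; apply: contraT => /(stable_gradient PsiP xst); rewrite gj => /eqP.
  by rewrite oppr_eq0 gt_eqF.
have Zn : enorm (descent A b x) ^+ 2 <= n%:R * descent A b x j 0 ^+ 2.
  have : enorm (descent A b x) <= Num.sqrt #|[set: 'I_n]%SET|%:R * descent A b x j 0.
    apply: enorm_le_card; [exact: ltW | move=> i | exact: finset.subsetT].
    by rewrite ger0_norm ?jmax //; exact: z_ge0.
  rewrite cardsT card_ord => h; rewrite -[n%:R]sqr_sqrtr ?ler0n // -exprMn.
  by rewrite ler_pXn2r ?nnegrE ?enorm_ge0 // mulr_ge0 ?sqrtr_ge0 // ltW.
have gP := gap_le_descent_sqr PsiP m0 n0 xs_stable xst.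
move: (descent A b x j 0) zj gj Zn jmax => zeta zj gj Zn jmax.
have Aj : col j A != 0.
  apply: contraTneq zj => Aj; rewrite -leNgt -oppr_ge0 -gj -dot_delta.
  by rewrite -dot_gradient -colE Aj /dot big1 // => i _; rewrite [X in _ * X]mxE mulr0.
have c0 : 0 < enorm (col j A) by rewrite enorm_gt0.
set t := zeta / enorm (col j A) ^+ 2.
have t0 : 0 < t by rewrite divr_gt0 // exprn_gt0.
have -> : (\col_i (if i == j then t else x i 0)) = x + t *: delta_mx j 0.
  apply/colP => i; rewrite !mxE; case: eqP => [->|_] /=.
    by rewrite xj add0r mulr1.
  by rewrite mulr0 addr0.
have costE : cost A b (x + t *: delta_mx j 0) =
    cost A b x - zeta ^+ 2 / enorm (col j A) ^+ 2.
  rewrite costD dotZr dot_delta gj -scalemxAr enormZ exprMn real_normK ?num_real //.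
  by rewrite -colE /t; field; rewrite gt_eqF.
have y0 : nonneg (x + t *: delta_mx j 0).
  by move=> i; rewrite !mxE addr_ge0 ?(xst.1 i) // mulr_ge0 ?(ltW t0).
split => //.
- apply: leq_trans (_ : #|j |: supp x| <= _)%N.
    apply/subset_leq_card/fintype.subsetP => i; rewrite !inE !mxE eqxx andbT.
    by have [//|_] := eqVneq i j; rewrite /= mulr0 addr0.
  by rewrite cardsU1 addnC leq_add2l; case: (_ \notin _).
- rewrite {2 3}/gap costE.
  have -> : cost A b x - cost A b xs -
    (cost A b x - zeta ^+ 2 / enorm (col j A) ^+ 2 - cost A b xs) =
    zeta ^+ 2 / enorm (col j A) ^+ 2 by ring.
  apply: le_trans gP _.
  rewrite mulrA ler_pdivlMr ?exprn_gt0 //.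
  have cS : enorm (col j A) ^+ 2 <= spectral_norm A ^+ 2.
    by rewrite ler_pXn2r ?nnegrE ?enorm_ge0 // col_le_spectral_norm.
  have := ler_pM (sqr_ge0 _) (sqr_ge0 _) Zn cS.
  move=> /(ler_wpM2l (sqr_ge0 proximity)).
  set u := proximity ^+ 2; set v := spectral_norm A ^+ 2; lra.
- move=> i; rewrite !mxE [_ + _ * _]addrC addrK.
  apply: (@le_trans _ _ t).
    by rewrite eqxx andbT; case: (i == j);
      rewrite ?mulr1 ?mulr0 ?normr0 ?ger0_norm // ltW.
  apply: (@le_trans _ _ (proximity * Num.sqrt (gap x))); last first.
    by rewrite ler_peMl ?(mulr_ge0 P0 (sqrtr_ge0 _)) ?ler1n.
  have dg : (zeta / enorm (col j A)) ^+ 2 <= gap x.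
    have := gap_ge0 xs_min y0; rewrite /gap costE expr_div_n; lra.
  have ds : zeta / enorm (col j A) <= Num.sqrt (gap x).
    rewrite -[leLHS]ger0_norm ?(ltW (divr_gt0 zj c0)) //.
    by rewrite -sqrtr_sqr ler_wsqrtr.
  have pc : 1 <= proximity * enorm (col j A).
    apply: le_trans (kappa_column_ge1 m0 n0 Aj) _.
    by rewrite ler_wpM2r ?enorm_ge0 // proximity_ge_kappa.
  have tE : t * enorm (col j A) = zeta / enorm (col j A).
    by rewrite /t; field; rewrite gt_eqF.
  apply: (@le_trans _ _ (proximity * (zeta / enorm (col j A)))); last first.
    by rewrite ler_wpM2l.
  by rewrite -tE mulrCA ler_peMr // ltW.
Qed.

End Updates.

(** * Counting the cycles *)

Section Counting.
Context {R : realType} {m n : nat} (A : 'M[R]_(m, n)) (b : 'cV[R]_m).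
Context (Psi : 'cV[R]_n -> 'cV[R]_n) (PsiP : cycle_free_centroid_mapping A b Psi).
Context (m0 : (0 < m)%N) (n0 : (0 < n)%N) (xs : 'cV[R]_n) (xs_stable : stable Psi xs).
Context (xs_min : forall y, nonneg y -> cost A b xs <= cost A b y).
Context (update : 'cV[R]_n -> 'cV[R]_n -> Prop) (a : nat) (D : R).
Context (D1 : 1 <= D) (updateP : decreasing_update A b Psi xs update a D).
Implicit Types (x y u : 'cV[R]_n).

Local Notation gap := (gap A b xs).
Local Notation proximity := (proximity A).

(** One major cycle has at most [n + 2] steps, each of length at most
[2 * proximity * sqrt gap].  Square roots of successive gaps shrink by a factor
of at most [1 - 1 / (2 * D)], so the geometric series contributes [2 * D]. *)
Definition threshold : R := 2 * D * (2 * proximity * (n%:R + 2)).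

Definition large x : {set 'I_n} :=
  [set i | threshold * Num.sqrt (gap x) < x i 0]%SET.

(** A factor by which the gap cannot drop without a new coordinate becoming
large; the square comes from zeroing the coordinates below the threshold. *)
Definition phase_drop : R :=
  (1 + spectral_norm A * (Num.sqrt n%:R * threshold)) ^+ 2 + 1.

Definition phase_length : R := D * ln phase_drop.

Lemma D_gt0 : 0 < D.
Proof. exact: lt_le_trans ltr01 D1. Qed.

Lemma contraction (g h : R) : g <= D * (g - h) -> h <= (1 - D^-1) * g.
Proof.
by move=> gh; rewrite -(ler_pM2l D_gt0) mulrA mulrBr mulr1 divff ?gt_eqF ?D_gt0 //; lra.
Qed.

Lemma threshold_ge0 : 0 <= threshold.
Proof.
have P0 := proximity_ge0 A m0 n0; have D0 := ltW D_gt0.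
apply: mulr_ge0; first exact: mulr_ge0.
by apply: mulr_ge0; [exact: mulr_ge0 | exact: addr_ge0].
Qed.

Lemma phase_drop_ge1 : 1 <= phase_drop.
Proof. by rewrite lerDr sqr_ge0. Qed.

Lemma phase_length_ge0 : 0 <= phase_length.
Proof. by rewrite mulr_ge0 ?(ltW D_gt0) // ln_ge0 ?phase_drop_ge1. Qed.

Lemma large_supp x : large x \subset supp x.
Proof.
apply/fintype.subsetP => i; rewrite !inE => xi; rewrite gt_eqF //.
by apply: le_lt_trans xi; rewrite mulr_ge0 ?threshold_ge0 ?sqrtr_ge0.
Qed.

(** The movement allowed in one major cycle is paid for by the decrease of
[threshold * Num.sqrt (gap x)], so large coordinates stay large. *)
Lemma large_subset x y : 0 <= gap x -> gap x <= D * (gap x - gap y) ->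
  (forall i, `|y i 0 - x i 0| <=
     2 * proximity * (n%:R + 2) * Num.sqrt (gap x)) ->
  large x \subset large y.
Proof.
move=> g0 gD yx; apply/fintype.subsetP => i; rewrite !inE => xi.
pose r := 1 - (2 * D)^-1.
have D2 : 0 < 2 * D by rewrite mulr_gt0 // D_gt0.
have r0 : 0 <= r by rewrite subr_ge0 invf_le1 //; have := D1; lra.
have gr : Num.sqrt (gap y) <= r * Num.sqrt (gap x).
  rewrite -[r]ger0_norm // -sqrtr_sqr -sqrtrM ?sqr_ge0 // ler_wsqrtr //.
  apply: le_trans (contraction gD) _; rewrite ler_wpM2r // /r.
  have := sqr_ge0 (2 * D)^-1; rewrite invfM => s0; rewrite sqrrB; lra.
have T0 := threshold_ge0.
apply: le_lt_trans (_ : threshold * (r * Num.sqrt (gap x)) < _).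
  by rewrite ler_wpM2l.
have tE : threshold * r = threshold - 2 * proximity * (n%:R + 2).
  by rewrite /r /threshold; field; rewrite gt_eqF ?D_gt0.
rewrite mulrA tE; have := yx i; rewrite ler_norml => /andP[yx1 _].
by move: xi yx1; lra.
Qed.

(** Zeroing the coordinates of [x] that are not large costs little, and the
stable point [x0] is at least as good as the result, whose support it
contains. *)
Lemma gap_before_drop x0 x : stable Psi x0 -> nonneg x ->
  large x \subset supp x0 -> gap x0 <= phase_drop * gap x.
Proof.
move=> st0 xn Lx; have g0 := gap_ge0 xs_min xn.
have T0 := threshold_ge0; have S0 := spectral_norm_ge0 A.
set sg := Num.sqrt (gap x).
have sg0 : 0 <= sg by rewrite sqrtr_ge0.
have sgE : gap x = sg ^+ 2 by rewrite sqr_sqrtr.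
pose y : 'cV[R]_n := \col_i if i \in large x then x i 0 else 0.
have yL : supp y \subset large x.
  apply/fintype.subsetP => i; rewrite in_supp mxE.
  by case: ifP => //; rewrite eqxx.
have x0y : cost A b x0 <= cost A b y.
  by apply: (stable_cost_le PsiP st0); exact: fintype.subset_trans yL Lx.
apply: le_trans (_ : gap y <= _); first by rewrite lerD2r.
have yx : enorm (y - x) <= Num.sqrt n%:R * (threshold * sg).
  rewrite -[n in Num.sqrt n%:R]card_ord -cardsT; apply: enorm_le_card.
  - by rewrite mulr_ge0.
  - move=> i; rewrite !mxE; case: ifP => [_|].
      by rewrite subrr normr0 mulr_ge0.
    by rewrite inE sub0r normrN ger0_norm ?xn // => /negbT; rewrite -leNgt.
  - exact: finset.subsetT.
have Ay : enorm (A *m (y - xs)) <=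
    sg + spectral_norm A * (Num.sqrt n%:R * (threshold * sg)).
  have -> : y - xs = (x - xs) + (y - x) by rewrite [RHS]addrC subrKA.
  rewrite mulmxDr; apply: le_trans (enorm_triangle _ _) _; apply: lerD.
    exact: image_dist_le_sqrt_gap xs_stable xs_min _ xn.
  by apply: le_trans (enorm_mulmx_le _ _) _; rewrite ler_wpM2l.
have gy : dot (gradient A b xs) y <= dot (gradient A b xs) x.
  apply: ler_sum => i _; rewrite ler_wpM2l //.
    exact: optimal_gradient_ge0 xs_stable xs_min i.
  by rewrite mxE; case: ifP.
have gx : 2 * dot (gradient A b xs) x <= gap x.
  by have := sqr_ge0 (enorm (A *m (x - xs))); rewrite (gapE PsiP xs_stable); lra.
have -> : phase_drop * gap x =
    (sg + spectral_norm A * (Num.sqrt n%:R * (threshold * sg))) ^+ 2 + gap x.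
  by rewrite sgE /phase_drop; ring.
rewrite [leLHS](gapE PsiP xs_stable); apply: lerD.
  by rewrite ler_pXn2r ?nnegrE ?enorm_ge0 // (le_trans (enorm_ge0 _) Ay).
by apply: le_trans gx; rewrite ler_wpM2l.
Qed.

(** As [1 - 1 / D <= exp (- 1 / D)], the gap drops by [phase_drop] within
[phase_length] steps. *)
Lemma rate_length (g h : R) k : 0 < h -> h <= (1 - D^-1) ^+ k * g ->
  g <= phase_drop * h -> k%:R <= phase_length.
Proof.
move=> h0 hg gh; have P0 : 0 < phase_drop := lt_le_trans ltr01 phase_drop_ge1.
have r0 : 0 <= 1 - D^-1 by rewrite subr_ge0 invf_le1 // D_gt0.
have re : (1 - D^-1) ^+ k <= expR (- (k%:R / D)).
  rewrite -mulrN expRM_natl.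
  by apply: lerXn2r; rewrite ?nnegrE ?expR_ge0 ?expR_ge1Dx.
have g0 : 0 <= g.
  rewrite leNgt; apply/negP => g0.
  by have := mulr_ge0_le0 (exprn_ge0 k r0) (ltW g0); lra.
have h1 : h <= expR (- (k%:R / D)) * phase_drop * h.
  apply: le_trans hg _; apply: le_trans (ler_wpM2r g0 re) _.
  by rewrite -mulrA ler_wpM2l ?expR_ge0.
have : 1 <= expR (- (k%:R / D)) * phase_drop by rewrite -(ler_pM2r h0) mul1r.
rewrite expRN mulrC ler_pdivlMr ?expR_gt0 // mul1r => eP.
rewrite /phase_length mulrC -ler_pdivrMr ?D_gt0 // -[leLHS]expRK ler_ln //.
by rewrite posrE expR_gt0.
Qed.

(** A phase starts when a coordinate becomes large.  As long as no further one
does, the large coordinates lie in the support of the stable point [x0] that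
opened the phase, which limits the length of the phase. *)
Definition major_invariant x (p : nat) : Prop :=
  stable Psi x /\ exists p0 x0,
    [/\ (p0 <= p)%N, stable Psi x0, large x \subset supp x0,
        gap x <= (1 - D^-1) ^+ (p - p0) * gap x0 &
        p0%:R <= (phase_length + 1) * #|large x|%:R /\
        (p - p0)%N%:R <= phase_length].

Lemma major_invariant_start : major_invariant 0 0.
Proof.
have st0 := zero_stable PsiP; split => //; exists 0%N, 0; split => //.
- exact: large_supp.
- by rewrite expr0 mul1r.
- by rewrite subn0 phase_length_ge0 mulr_ge0 // addr_ge0 ?phase_length_ge0.
Qed.

Lemma major_invariant_next x y p : major_invariant x p ->
  stable Psi y -> 0 < gap y -> gap x <= D * (gap x - gap y) ->
  (forall i, `|y i 0 - x i 0| <=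
     2 * proximity * (n%:R + 2) * Num.sqrt (gap x)) ->
  major_invariant y p.+1.
Proof.
move=> [xst [p0 [x0 [p0p st0 Lx gx [p0L pT]]]]] yst gy gD yx; split => //.
have g0 := gap_ge0 xs_min xst.1.
have Lxy := large_subset g0 gD yx.
have T0 := phase_length_ge0.
(* Either the phase goes on, or [y] opens a new one. *)
have [LL|nLL] := boolP (large x == large y); last first.
  exists p.+1, y; split => //; first exact: large_supp.
    by rewrite subnn expr0 mul1r.
  split; last by rewrite subnn.
  have : (#|large x| < #|large y|)%N.
    by apply: proper_card; rewrite finset.properEneq nLL.
  rewrite -(ler_nat R) -[#|large x|.+1]addn1 natrD => cL.
  have {}pT : p%:R <= p0%:R + phase_length.
    by rewrite -{1}(subnKC p0p) natrD lerD2l.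
  rewrite -[p.+1]addn1 natrD.
  apply: le_trans (_ : (phase_length + 1) * (#|large x|%:R + 1) <= _); first lra.
  by rewrite ler_wpM2l // addr_ge0.
have LE := eqP LL.
have gy1 : gap y <= (1 - D^-1) ^+ (p.+1 - p0) * gap x0.
  rewrite subSn // exprS -mulrA.
  apply: le_trans (contraction gD) _.
  by rewrite ler_wpM2l // subr_ge0 invf_le1 // D_gt0.
exists p0, x0; split => //; first exact: leqW.
  by rewrite -LE.
split; first by rewrite -LE.
apply: rate_length gy gy1 _; apply: gap_before_drop => //; first exact: yst.1.
by rewrite -LE.
Qed.

Definition major_bound : R := (phase_length + 1) * (n%:R + 1).

Lemma major_invariant_bound x p : major_invariant x p ->
  p.+1%:R <= major_bound.
Proof.
move=> [_ [p0 [x0 [p0p _ _ _ [p0L pT]]]]]; have T0 := phase_length_ge0.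
have Ln : (#|large x|%:R : R) <= n%:R.
  by rewrite ler_nat -[n in leqRHS]card_ord max_card.
have : p0%:R <= (phase_length + 1) * n%:R.
  by apply: le_trans p0L _; rewrite ler_wpM2l // addr_ge0.
rewrite -[p.+1]addn1 natrD -{1}(subnKC p0p) natrD /major_bound; lra.
Qed.

(** Here [x] is the start of the major cycle and [y] is reached from it by [k]
steps.  The inequality between cardinals bounds [k] by [n + 2]: every minor cycle
but the last one, which ends in a stable point, removes an index from the
support. *)
Definition minor_invariant y (p : nat) : Prop :=
  exists x p' k, [/\ p = p'.+1, major_invariant x p', nonneg y,
    gap x <= D * (gap x - gap y) &
    (k + #|supp y| <= n + 1 + (Psi y == y))%N /\
    forall i, `|y i 0 - x i 0| <= 2 * proximity * k%:R * Num.sqrt (gap x)].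

Lemma minor_invariant_update x y p : major_invariant x p -> update x y ->
  minor_invariant y p.+1.
Proof.
move=> xI xy; have [y0 _ gD yx] := update_step updateP xI.1 xy.
exists x, p, 1%N; split => //; split.
  have : (#|supp y| <= n)%N by rewrite -[n in leqRHS]card_ord max_card.
  by move=> sy; rewrite addnC -addnA leq_add // leq_addr.
by move=> i; rewrite mulr1 -mulrA.
Qed.

Lemma gap_decrease x y : 0 <= gap x -> gap x <= D * (gap x - gap y) ->
  gap y <= gap x.
Proof.
move=> g0 gD; have : 0 <= D * (gap x - gap y) by exact: le_trans gD.
by rewrite pmulr_rge0 ?D_gt0 // subr_ge0.
Qed.

Lemma minor_invariant_cycle y u p : minor_invariant y p -> Psi y <> y ->
  minor_cycle Psi y u -> minor_invariant u p.
Proof.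
move=> [x [p' [k [-> xI y0 gD [ky yx]]]]] ny yu.
have [u0 uy uP] := minor_cycle_support PsiP y0 yu.
have dec := minor_cycle_decrease PsiP m0 n0 y0 yu.
have cu := minor_cycle_cost PsiP m0 n0 y0 yu.
have gu : gap u <= gap y by rewrite lerD2r.
have gx0 := gap_ge0 xs_min xI.1.1.
have gyx := gap_decrease gx0 gD.
exists x, p', k.+1; split => //.
  by apply: le_trans gD _; rewrite ler_wpM2l ?(ltW D_gt0) // lerB.
have nyE : (Psi y == y) = false by apply/eqP.
split.
  move: ky; rewrite nyE; case: uP => [[_ ->]|/proper_card]; last by lia.
  by rewrite eqxx; have := subset_leq_card uy; lia.
move=> i; rewrite -(subrKA (y i 0)).
apply: le_trans (ler_normD _ _) _.
have -> : 2 * proximity * k.+1%:R * Num.sqrt (gap x) =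
    2 * proximity * Num.sqrt (gap x) + 2 * proximity * k%:R * Num.sqrt (gap x).
  by rewrite -[k.+1]addn1 natrD; ring.
apply: lerD (yx i).
have P0 := proximity_ge0 A m0 n0.
apply: le_trans (_ : proximity * Num.sqrt (gap x) <= _); last first.
  by rewrite -mulrA ler_peMl ?(mulr_ge0 P0 (sqrtr_ge0 _)) // ler1n.
have := coord_le_enorm (u - y) i; rewrite !mxE => /le_trans; apply.
rewrite -[leLHS]ger0_norm ?enorm_ge0 // -[X in X * _]ger0_norm // -!sqrtr_sqr.
rewrite -sqrtrM ?sqr_ge0 // ler_wsqrtr //.
apply: le_trans dec _; rewrite ler_wpM2l ?sqr_ge0 //.
have := gap_ge0 xs_min u0; move: gyx; rewrite /gap; lra.
Qed.

Lemma major_invariant_repeat y p : minor_invariant y p -> Psi y = y ->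
  ~ update y y -> major_invariant y p.
Proof.
move=> [x [p' [k [-> xI y0 gD [ky yx]]]]] yE nu.
have yst : stable Psi y by [].
apply: major_invariant_next xI yst _ gD _.
  by rewrite ltNge; apply/negP => gy; apply/nu/(update_optimal updateP).
move=> i; apply: le_trans (yx i) _.
have P2 : 0 <= 2 * proximity by rewrite mulr_ge0 ?(proximity_ge0 A m0 n0).
rewrite ler_wpM2r ?sqrtr_ge0 // ler_wpM2l //.
rewrite -(natrD _ n 2) ler_nat; move: ky; rewrite yE eqxx; lia.
Qed.

(** The size of the support is a credit for minor cycles: an update earns [a], and
a minor cycle spends one unit unless it is the last of its major cycle.  The
update earns one more unit for that last cycle, which is kept in reserve until
the point is stable. *)
Definition config_invariant (c : config R n) (p q : nat) : Prop :=
  match c with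
  | Major x => major_invariant x p /\ (q + #|supp x| <= a.+1 * p)%N
  | Minor y => minor_invariant y p /\
      (q + #|supp y| + (Psi y != y) <= a.+1 * p)%N
  | Returned x => [/\ optimal A b x, p%:R <= major_bound & (q <= a.+1 * p)%N]
  end.

Lemma run_invariant c p q : run update Psi 0 c p q -> config_invariant c p q.
Proof.
elim=> {c p q} [|x y p q _ [xI xq] xy|y u p q _ [yI yq] ny yu
               |y p q _ [yI yq] yE nu|y p q _ [yI yq] yE uy] /=.
- split; first exact: major_invariant_start.
  have /eqP -> : supp (0 : 'cV[R]_n) == finset.set0 by rewrite supp_eq0.
  by rewrite cards0.
- split; first exact: minor_invariant_update xI xy.
  have [_ sy _ _] := update_step updateP xI.1 xy.
  rewrite mulnS; move: xq sy (leq_b1 (Psi y != y)).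
  move: #|supp x| #|supp y| (nat_of_bool _) (_ * _)%N => sx sy c ap; lia.
- split; first exact: minor_invariant_cycle yI ny yu.
  have [x [p' [k [_ _ y0 _ _]]]] := yI.
  have [u0 uy uP] := minor_cycle_support PsiP y0 yu.
  move: yq; have -> : (Psi y != y) by apply/eqP.
  case: uP => [[_ ->]|/proper_card].
    rewrite eqxx /= addn0; have := subset_leq_card uy.
    by move: #|supp u| #|supp y| (_ * _)%N => su sy ap; lia.
  have := leq_b1 (Psi u != u).
  by move: #|supp u| #|supp y| (nat_of_bool (Psi u != u)) (_ * _)%N => su sy c ap; lia.
- split; first exact: major_invariant_repeat yI yE nu.
  by apply: leq_trans yq; exact: leq_addr.
- have [x [p' [k [pE xI y0 gD ky]]]] := yI; split.
  + apply: (gap_optimal xs_min) => //.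
    have [_ _ + _] := update_step updateP (conj y0 yE) uy.
    by rewrite subrr mulr0.
  + by rewrite pE; exact: major_invariant_bound xI.
  + by apply: leq_trans yq; rewrite -addnA leq_addr.
Qed.

Lemma solves_within_bound :
  solves_within A b update Psi 0 major_bound (a.+1%:R * major_bound).
Proof.
move=> c p q /run_invariant cI.
have [pb qb] : p%:R <= major_bound /\ (q <= a.+1 * p)%N.
  move: cI; case: c => [x [xI xq]|y [yI yq]|x []] //=.
    split; last by apply: leq_trans xq; exact: leq_addr.
    by apply: le_trans (major_invariant_bound xI); rewrite ler_nat.
  split; last by apply: leq_trans yq; rewrite -addnA leq_addr.
  by have [x [p' [k [-> xI _ _ _]]]] := yI; exact: major_invariant_bound xI.
split => //.
  apply: le_trans (_ : (a.+1 * p)%N%:R <= _); first by rewrite ler_nat.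
  by rewrite natrM ler_wpM2l.
case: c cI => [x _|y [yI _]|x [ox _ _]].
- by left; exact: update_exists updateP x.
- left => /= _; have [x [p' [k [_ _ y0 _ _]]]] := yI.
  by have := minor_cycle_exists PsiP y0.
- by right; exists x.
Qed.

End Counting.

(** * The bounds *)

Section Bounds.
Context {R : realType} {m n : nat} (A : 'M[R]_(m, n)).
Context (m0 : (0 < m)%N) (n0 : (0 < n)%N) (rA : \rank A = m).

Local Notation kappa := (circuit_imbalance (XA A)).
Local Notation S := (spectral_norm A).
Local Notation q := (n%:R + kappa).

(** As [n + kappa >= 2]. *)
Lemma ln_size_ge : 1 <= 2 * ln q.
Proof.
have k1 := kappa_ge1 A m0 n0; have n1 : 1 <= n%:R :> R by rewrite ler1n.
have : ln 2 <= ln q by rewrite ler_ln ?posrE //; lra.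
have := @le_ln1Dx R (- 2^-1); rewrite (_ : 1 + - 2^-1 = 2^-1); last by field.
rewrite lnV ?posrE //; lra.
Qed.

Lemma rate_ge1 : 1 <= proximity A ^+ 2 * S ^+ 2.
Proof.
have h := kappa_spectral_norm_ge1 m0 n0 rA.
have S0 := spectral_norm_ge0 A.
rewrite -exprMn exprn_ege1 //; apply: le_trans h _.
by rewrite ler_wpM2r // proximity_ge_kappa.
Qed.

(** All parameters are polynomial in [n + kappa]; the entries of [A], in
particular, are at most [kappa]. *)
Lemma ln_phase_drop (D : R) :
  1 <= D -> D <= n%:R * (proximity A ^+ 2 * S ^+ 2) ->
  ln (phase_drop A D) <= 39 * ln q.
Proof.
move=> D1 Dle.
have k1 := kappa_ge1 A m0 n0; have n1 : 1 <= n%:R :> R by rewrite ler1n.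
have q2 : 2 <= q by lra.
have q1 : 1 <= q by lra.
have q0 : 0 < q by lra.
have mn : (m <= n)%N by rewrite -rA rank_leq_col.
have nq : n%:R <= q by lra.
have kq : kappa <= q by lra.
have mq : m%:R <= q by apply: le_trans nq; rewrite ler_nat.
have P0 := proximity_ge0 A m0 n0; have S0 := spectral_norm_ge0 A.
have Pq : proximity A <= q ^+ 2 by rewrite expr2 ler_pM ?(le_trans ler01 k1).
have Sq : S <= q ^+ 2.
  apply: le_trans (spectral_norm_le_kappa A m0 n0 mn) _.
  by rewrite expr2 ler_pM ?(le_trans ler01 k1).
(* Degrees in [n + kappa] add up under products. *)
have pw k l (x y : R) : 0 <= x -> 0 <= y -> x <= q ^+ k -> y <= q ^+ l ->
    x * y <= q ^+ (k + l).
  by move=> x0 y0 xk yl; rewrite exprD ler_pM.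
have Dq : D <= q ^+ 9.
  apply: le_trans Dle _; apply: (pw 1%N 8) => //.
    by rewrite mulr_ge0 ?sqr_ge0.
  apply: (pw 4%N 4%N); rewrite ?sqr_ge0 //.
    by apply: (pw 2%N 2%N).
  by apply: (pw 2%N 2%N).
have D0 : 0 <= D by lra.
have n2 : n%:R + 2 <= q ^+ 2.
  by rewrite expr2; apply: le_trans (_ : 2 * q <= _); [lra | rewrite ler_wpM2r // ltW].
have Tq : threshold A D <= q ^+ 15.
  apply: (pw 10%N 5%N).
  - by rewrite mulr_ge0.
  - by rewrite mulr_ge0 // ?addr_ge0 // mulr_ge0.
  - by apply: (pw 1%N 9%N).
  - apply: (pw 3%N 2%N) => //; [by rewrite mulr_ge0 | by rewrite addr_ge0 |].
    by apply: (pw 1%N 2%N).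
have T0 : 0 <= threshold A D := threshold_ge0 A m0 n0 D1.
have rn : Num.sqrt n%:R <= q.
  apply: le_trans nq; rewrite -[leRHS]ger0_norm // -sqrtr_sqr ler_wsqrtr //.
  by rewrite expr2 ler_peMl.
have Uq : S * (Num.sqrt n%:R * threshold A D) <= q ^+ 18.
  apply: (pw 2%N 16%N) => //; first by rewrite mulr_ge0 ?sqrtr_ge0.
  by apply: (pw 1%N 15%N); rewrite ?sqrtr_ge0.
have U0 : 0 <= S * (Num.sqrt n%:R * threshold A D).
  by rewrite mulr_ge0 // mulr_ge0 ?sqrtr_ge0.
have step k : 1 + q ^+ k <= q ^+ k.+1.
  have : 1 <= q ^+ k by rewrite exprn_ege1.
  by move=> qk; rewrite exprS; apply: le_trans (_ : 2 * q ^+ k <= _);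
    [lra | rewrite ler_wpM2r // exprn_ge0 // ltW].
have Pdq : phase_drop A D <= q ^+ 39.
  apply: le_trans (step 38%N); rewrite /phase_drop [leLHS]addrC.
  rewrite lerD2l (_ : 38%N = (19 * 2)%N) // exprM.
  apply: lerXn2r; rewrite ?nnegrE ?addr_ge0 ?exprn_ge0 ?(ltW q0) //.
  by apply: le_trans (step 18%N); rewrite lerD2l.
have Pd0 : 0 < phase_drop A D := lt_le_trans ltr01 (phase_drop_ge1 A D).
have : ln (phase_drop A D) <= ln (q ^+ 39) by rewrite ler_ln ?posrE ?exprn_gt0.
by rewrite lnXn // mulr_natl.
Qed.

(** [82 = 2 * (39 + 2)]: the 39 bounds [ln phase_drop], a summand 1 is at most
[2 * ln (n + kappa)], and [n + 1 <= 2 * n]. *)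
Lemma major_bound_le (D : R) :
  1 <= D -> D <= n%:R * (proximity A ^+ 2 * S ^+ 2) ->
  major_bound A D <= 82 * n%:R * D * ln q.
Proof.
move=> D1 Dle; have lP := ln_phase_drop D1 Dle; have l1 := ln_size_ge.
have n1 : 1 <= n%:R :> R by rewrite ler1n.
have D0 : 0 <= D by lra.
have h1 : phase_length A D + 1 <= 41 * (D * ln q).
  have := ler_wpM2l D0 lP; have := ler_wpM2l D0 l1.
  by rewrite /phase_length; lra.
have h0 : 0 <= 41 * (D * ln q) by rewrite !mulr_ge0 //; lra.
have h2 : n%:R + 1 <= 2 * n%:R :> R by lra.
rewrite /major_bound; apply: le_trans (ler_wpM2r _ h1) _; first by lra.
by apply: le_trans (ler_wpM2l h0 h2) _; lra.
Qed.

End Bounds.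

Lemma solves_within_weaken (R : realType) (m n : nat) (A : 'M[R]_(m, n)) b update
    Psi x0 (M M' N N' : R) : M <= M' -> N <= N' ->
  solves_within A b update Psi x0 M N -> solves_within A b update Psi x0 M' N'.
Proof.
move=> MM NN h c p q /h[pM qN cc]; split => //; first exact: le_trans MM.
exact: le_trans NN.
Qed.

Theorem theorem4p1 (R : realType) :
  exists2 C : R, 0 < C &
  forall (m n : nat) (A : 'M[R]_(m, n)) (b : 'cV[R]_m)
         (Psi : 'cV[R]_n -> 'cV[R]_n),
  (0 < m)%N -> (0 < n)%N -> \rank A = m ->
  cycle_free_centroid_mapping A b Psi ->
  let kappa := circuit_imbalance (XA A) in
  let bound_i := C * n%:R * m%:R ^+ 2 * kappa ^+ 2 * spectral_norm A ^+ 2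
                 * ln (n%:R + kappa) in
  let bound_ii := C * n%:R ^+ 2 * m%:R ^+ 2 * kappa ^+ 2 * spectral_norm A ^+ 2
                  * ln (n%:R + kappa) in
  solves_within A b (projected_gradient_update A b) Psi 0 bound_i bound_ii /\
  solves_within A b (coordinate_update A b) Psi 0 bound_ii bound_ii.
Proof.
(* The projected gradient update allows [n + 1 <= 2 * n] minor cycles per major
cycle, the coordinate update two: a factor of 2 on top of the 82. *)
exists 164 => // m n A b Psi m0 n0 rA PsiP kappa bound_i bound_ii.
have [xs xs_stable xs_min] := optimum_exists PsiP m0 n0.
pose E := proximity A ^+ 2 * spectral_norm A ^+ 2.
have E1 : 1 <= E := rate_ge1 m0 n0 rA.
have n1 : 1 <= n%:R :> R by rewrite ler1n.
have L0 : 0 <= ln (n%:R + kappa) by have := ln_size_ge A m0 n0; rewrite -/kappa; lra.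
have E0 : 0 <= E by lra.
have X0 : 0 <= E * ln (n%:R + kappa) by exact: mulr_ge0.
have nn : n%:R <= n%:R ^+ 2 :> R by rewrite expr2 ler_peMl //; lra.
have biE : bound_i = 164 * n%:R * E * ln (n%:R + kappa).
  by rewrite /bound_i /E /proximity -/kappa; ring.
have biiE : bound_ii = 164 * n%:R ^+ 2 * E * ln (n%:R + kappa).
  by rewrite /bound_ii /E /proximity -/kappa; ring.
split.
  have EE : E <= n%:R * E by rewrite ler_peMl.
  have := major_bound_le m0 n0 rA E1 EE; rewrite -/kappa => Mle.
  have M0 : 0 <= 82 * n%:R * E * ln (n%:R + kappa).
    by rewrite -mulrA mulr_ge0 //; lra.
  apply: solves_within_weaken (solves_within_bound PsiP m0 n0 xs_stable xs_min E1
    (projected_gradient_decreasing PsiP m0 n0 xs_stable xs_min)).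
    by apply: le_trans Mle _; rewrite biE; lra.
  apply: le_trans (ler_wpM2l (ler0n _ _) Mle) _.
  apply: le_trans (_ : (2 * n%:R) * (82 * n%:R * E * ln (n%:R + kappa)) <= _).
    by rewrite ler_wpM2r // -[n.+1]addn1 natrD; lra.
  by rewrite biiE le_eqVlt; apply/orP; left; apply/eqP; ring.
have nE1 : 1 <= n%:R * E by apply: le_trans E1 _; rewrite ler_peMl.
have := major_bound_le m0 n0 rA nE1 (lexx _); rewrite -/kappa => Mle.
have Y0 : 0 <= n%:R ^+ 2 * (E * ln (n%:R + kappa)) by rewrite mulr_ge0 ?sqr_ge0.
apply: solves_within_weaken (solves_within_bound PsiP m0 n0 xs_stable xs_min nE1
  (coordinate_decreasing PsiP m0 n0 xs_stable xs_min)).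
  by apply: le_trans Mle _; rewrite biiE; lra.
apply: le_trans (ler_wpM2l (ler0n _ _) Mle) _.
by rewrite biiE le_eqVlt; apply/orP; left; apply/eqP; ring.
Qed.
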